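(* Let $\lambda\in(0,\infty)$, $\theta\in\mathbb{R}$, $\beta=\beta_n=\tfrac13+\frac{\theta}{\log n}$, and let $G_n$ be an observation from the exponential random graph law $\mathbb{P}_\beta$ on graphs with vertex set $[n]$ given by $$\frac{d\mathbb{P}_\beta}{d\mathbb{P}}(G_n)=\frac{1}{Z_n(\beta)}\,\mathrm{e}^{\beta\log n\,V_T(G_n)},$$ where $\mathbb{P}$ is the law of the Erdős–Rényi random graph $G(n,\lambda/n)$ and $Z_n(\beta)$ is the normalising constant. Define $$\hat\lambda_n=\frac{2E(G_n)}{n}-\frac{2V_T(G_n)}{n}$$ and let $\hat\theta_n$ be the value $x\in\mathbb{R}$ for which $$\arg\max_{0\le a\le1}\Lambda(a,x,\hat\lambda_n)=\frac{V_T(G_n)}{n}.$$ Then $\hat\lambda_n\to\lambda$ and $\hat\theta_n\to\theta$ in probability under $\mathbb{P}_\beta$ as $n\to\infty$.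
   Context: $G(n,p)$ is the random simple graph on vertex set $[n]=\{1,\dots,n\}$ in which each possible edge is present independently with probability $p$. For a graph $G$, $V_T(G)$ is the number of vertices of $G$ that belong to at least one triangle of $G$, and $E(G)$ (in $E(G_n)/n$) denotes the number of edges of $G$. The function $\Lambda$ is $$\Lambda(a,\theta,\lambda)=\theta a-(1-a)\log(1-a)-(\tfrac13a)\log(\tfrac13a)-\tfrac23a-\tfrac13a\log6+a\log\lambda,$$ for $a\in[0,1]$, $\theta\in\mathbb{R}$, $\lambda>0$, with $0\log0=0$. On the event that no unique $x$ as in the definition of $\hat\theta_n$ exists (for instance if $\hat\lambda_n\le0$ or $V_T(G_n)\in\{0,n\}$), $\hat\theta_n$ is assigned an arbitrary value. *)

(* Defs.v *)
From HB Require Import structures.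
From mathcomp Require Import all_boot all_order all_algebra.
From mathcomp Require Import all_classical all_reals all_analysis.

Set Implicit Arguments.
Unset Strict Implicit.
Unset Printing Implicit Defensive.

Import Order.TTheory GRing.Theory Num.Theory.
Import numFieldNormedType.Exports.

Local Open Scope ring_scope.

Definition edge (n : nat) := {e : {set 'I_n} | #|e| == 2%N}.

(* Every set of unordered pairs of distinct vertices is a simple graph, so no
   side condition is needed; the number of edges of [G] is [#|G|]. *)
Definition graph (n : nat) := {set edge n}.

(* [adj G i j] forces [i != j], since an edge has exactly two elements. *)
Definition adj (n : nat) (G : graph n) (i j : 'I_n) : bool :=
  [exists e : edge n, (e \in G) && (val e == [set i; j]%SET)].

Definition in_triangle (n : nat) (G : graph n) (v : 'I_n) : bool :=
  [exists u : 'I_n, exists w : 'I_n, [&& adj G v u, adj G u w & adj G w v]].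

Definition V_T (n : nat) (G : graph n) : nat :=
  #|[set v : 'I_n | in_triangle G v]%SET|.

(* Mass function of G(n,p). It is a probability only for [0 <= p <= 1]; with
   [p = lambda / n] this holds as soon as [n >= lambda]. *)
Definition er_pmf (R : realType) (n : nat) (p : R) (G : graph n) : R :=
  \prod_(e : edge n) (if e \in G then p else 1 - p).

Definition ergm_density (R : realType) (n : nat) (beta : R) (G : graph n) : R :=
  expR (beta * ln n%:R * (V_T G)%:R).

Definition ergm_Z (R : realType) (n : nat) (p beta : R) : R :=
  \sum_(G : graph n) ergm_density beta G * er_pmf p G.

Definition ergm_prob (R : realType) (n : nat) (p beta : R)
    (A : pred (graph n)) : R :=
  \sum_(G : graph n | A G)
    (ergm_Z n p beta)^-1 * ergm_density beta G * er_pmf p G.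

Definition cvg_in_prob (R : realType) (Pr : forall n, pred (graph n) -> R)
    (X : forall n, graph n -> R) (l : R) : Prop :=
  forall eps : R, 0 < eps ->
    ((fun n => Pr n (fun G => eps < `|X n G - l|)) @ \oo --> (0 : R))%classic.

(* The convention 0 log 0 = 0 holds because the logarithm is multiplied by 0
   (and is itself 0 outside the positive reals). *)
Definition Lambda (R : realType) (a theta lambda : R) : R :=
  theta * a - (1 - a) * ln (1 - a) - (a / 3) * ln (a / 3)
  - 2 / 3 * a - a / 3 * ln 6 + a * ln lambda.

Definition argmax (R : realType) (D : set R) (f : R -> R) : set R :=
  [set a | D a /\ forall b, D b -> f b <= f a]%classic.

Definition lambda_hat (R : realType) (n : nat) (G : graph n) : R :=
  2 * #|G|%:R / n%:R - 2 * (V_T G)%:R / n%:R.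

(* [Lambda a x l] is only meaningful for [l > 0], so positivity of the estimate
   is part of the defining equation: [ln] is total in the library, and without
   it the equation could have a spurious solution. *)
Definition theta_hat_eq (R : realType) (n : nat) (G : graph n) (x : R) : Prop :=
  0 < lambda_hat R G /\
  argmax `[0, 1]%classic (fun a => Lambda a x (lambda_hat R G))
    = [set (V_T G)%:R / n%:R]%classic.

(* When there is no unique solution, the value is left unconstrained. *)
Definition is_theta_hat (R : realType)
    (theta_hat : forall n, graph n -> R) : Prop :=
  forall (n : nat) (G : graph n) (x : R),
    unique (theta_hat_eq G) x -> theta_hat n G = x.

(* Main.v *)
Require Import Defs.
From HB Require Import structures.
From mathcomp Require Import all_boot all_order all_algebra.
From mathcomp Require Import all_classical all_reals all_analysis.
From mathcomp Require Import ring lra zify.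

(** Under the law with parameter beta a graph [G] has probability proportional to
    [x ^+ V_T G * w ^+ #|G|], where [x] is [n^(1/3) e^theta] and
    [w = p / (1 - p) = lambda / (n - lambda)].  Let [W(x, w)] be the sum of these
    weights over all graphs.  The exponential moments of the pair
    [(V_T G, #|G|)] are quotients [W(x e^b, w e^t) / W(x, w)], so both
    convergences follow from Markov's inequality once [W] is known up to a factor
    [e^(o(n))], for [x] of order [n^(1/3)] and [w] of order [1/n].  In this range
      [W(x, w) = e^(o(n)) (1 + w)^N M(x^3 w^3)],
    with [N] the number of pairs of vertices and [M(z)] the sum of [z^|F|] over
    the families [F] of pairwise disjoint triples of vertices: to exponential
    precision, the triangles of the graph may be taken to be disjoint, and the
    other edges to be independent.

    Upper bound ([graph_sum_le]).  Take in [G] a maximal family [F] of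
    edge-disjoint triangles.  Every triangle shares an edge with a member of [F],
    so a vertex of a triangle is either covered by [F] or joined to both ends of
    an edge of a member of [F].  A vertex of the second kind costs two new
    edges, hence the factor [x w^2] per choice of that edge; altogether such
    vertices give at most
    [(1 + 3|F| x w^2)^n <= e^(3 n x w^2 |F|)], a factor close to 1 for each
    triangle of [F] ([apex_sum]).  Next, [F] splits into a maximal subfamily of
    disjoint triangles and remaining triangles, each of which covers at most two
    more vertices at the cost of three edges; as there are at most [n^3] triples,
    the latter contribute [(1 + x^2 w^3 ...)^(n^3) = e^(O(n^(2/3)))]
    ([sum_cover_le]).

    Lower bound ([graph_sum_ge]).  Each family of disjoint triples is completed
    to a graph by arbitrary further edges.  On average this creates [O(1)]
    triangles outside the family, since a triple outside it has at most one pair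
    in common with it, so a graph with [O(1)] extra triangles is typical; and such
    a graph arises from only polynomially many families.

    Since [M] is evaluated at [x^3 w^3], a tilt by [t (#|G| - V_T G)] leaves it
    unchanged, so [#|G| - V_T G] has to exponential precision the exponential
    moments of a binomial variable with parameters [N] and [lambda / n].  This
    gives the convergence of [lambda_hat].  For [V_T G], consecutive coefficients
    of [M] satisfy [(m + 1) c_(m+1) = C(n - 3 m, 3) c_m], so the terms
    [c_m z^m] increase and then decrease geometrically around [3 m = a n], where
    [2 a = lambda^3 e^(3 theta) (1 - a)^3]; hence [V_T G / n] concentrates at [a].

    Finally Gibbs' inequality shows that [Lambda(., x, l)] has the single
    maximiser [v] in [(0, 1)] given by
    [x = log (2 v) / 3 - log (1 - v) - log l], and [v] determines [x].  So
    [theta_hat] is this function of [V_T G / n] and [lambda_hat], which is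
    continuous and takes the value [theta] at [(a, lambda)]. *)

Set Implicit Arguments.
Unset Strict Implicit.
Unset Printing Implicit Defensive.

Import Order.TTheory GRing.Theory Num.Theory.
Import numFieldNormedType.Exports.

Local Open Scope ring_scope.

(** * Sums over families of finite sets *)

(** The sets between [H] and [B] are chosen element by element, so the sum is an
    expanded product over the elements of [B] outside [H]. *)
Lemma sum_interval (T : finType) (R : comPzRingType) (w : R) (H B : {set T}) :
  H \subset B ->
  \sum_(A : {set T} | (H \subset A) && (A \subset B)) w ^+ #|(A :\: H)%SET|
  = (1 + w) ^+ #|(B :\: H)%SET|.
Proof.
move=> HB.
transitivity (\prod_(i : T) ((if i \in H then 1 else if i \in B then w else 0)
                             + (i \notin H)%:R)).
  rewrite bigA_distr big_mkcond; apply: eq_bigr => A _.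
  case: ifPn => [/andP[/fintype.subsetP HA /fintype.subsetP AB]|].
    rewrite -prodr_const [LHS]big_mkcond; apply: eq_bigr => i _.
    rewrite !inE; case: (boolP (i \in H)) => [/HA ->//|iH] /=.
    by case: (boolP (i \in A)) => //= /AB ->.
  rewrite negb_and => /ssrbool.orP[]/fintype.subsetPn[i i1 i2].
    by rewrite (bigD1 i) //= (negbTE i2) i1 mul0r.
  have iH : i \notin H by apply: contra i2; apply: (fintype.subsetP HB).
  by rewrite (bigD1 i) //= i1 (negbTE i2) (negbTE iH) mul0r.
rewrite -prodr_const [RHS]big_mkcond; apply: eq_bigr => i _.
rewrite !inE; case: (i \in H) => /=; first by rewrite addr0.
by case: ifP => _; rewrite ?add0r // addrC.
Qed.

Lemma sum_supersets (T : finType) (R : comPzRingType) (w : R) (H : {set T}) :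
  \sum_(G : {set T} | H \subset G) w ^+ #|G|
  = w ^+ #|H| * (1 + w) ^+ #|(~: H)%SET|.
Proof.
rewrite -finset.setTD -sum_interval ?finset.subsetT // mulr_sumr.
apply: eq_big => [G|G HG]; first by rewrite finset.subsetT andbT.
by rewrite -exprD cardsD (finset.setIidPr HG) subnKC // subset_leq_card.
Qed.

Lemma sum_subsets (T : finType) (R : comPzRingType) (w : R) (B : {set T}) :
  \sum_(A : {set T} | A \subset B) w ^+ #|A| = (1 + w) ^+ #|B|.
Proof.
rewrite -{2}[B]finset.setD0 -sum_interval ?finset.sub0set //.
by apply: eq_big => [A|A _]; rewrite ?finset.sub0set ?finset.setD0.
Qed.

Lemma sum_subset_complements (R : comPzRingType) (T : finType) (d : R) (B : {set T}) :
  \sum_(A : {set T} | A \subset B) d ^+ #|(B :\: A)%SET| = (1 + d) ^+ #|B|.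
Proof.
rewrite -sum_subsets (reindex_onto (fun A => B :\: A)%SET (fun A => B :\: A)%SET).
  apply: eq_big => [A|A].
    rewrite finset.subsetDl /=; apply/eqP/idP => [<-|AB].
      exact: finset.subsetDl.
    by rewrite finset.setDDr finset.setDv finset.set0U (finset.setIidPr AB).
  by rewrite finset.subsetDl /= => /eqP ->.
by move=> A AB; rewrite finset.setDDr finset.setDv finset.set0U (finset.setIidPr AB).
Qed.

Lemma sum_supersets_le (R : realType) (T : finType) (w : R) (H : {set T}) :
  0 <= w ->
  \sum_(G : {set T} | H \subset G) w ^+ #|G| <= (1 + w) ^+ #|T| * w ^+ #|H|.
Proof.
move=> w0; rewrite sum_supersets mulrC ler_wpM2r ?exprn_ge0 //.
by rewrite ler_weXn2l ?lerDl // max_card.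
Qed.

Lemma big_option (R : Type) (idx : R) (op : Monoid.com_law idx) (T : finType)
    (F : option T -> R) :
  \big[op/idx]_(o : option T) F o
  = op (F None) (\big[op/idx]_(t : T) F (Some t)).
Proof.
rewrite (bigD1 None) //=; congr (op _ _).
rewrite (reindex_omap Some id) /=; last by case.
by apply: eq_bigl => t; rewrite eqxx.
Qed.

(** * Packings *)

(** The members of [F] may be disjoint as vertex sets ([h := id]) or share no edge
    ([h := pairs_in]); both kinds of packing occur below. *)
Definition packing (I S : finType) (h : I -> {set S}) (F : {set I}) : bool :=
  [forall i in F, forall j in F, (i != j) ==> [disjoint h i & h j]].

Lemma packingP (I S : finType) (h : I -> {set S}) (F : {set I}) :
  reflect (forall i j, i \in F -> j \in F -> i != j -> [disjoint h i & h j])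
          (packing h F).
Proof.
apply: (iffP forall_inP) => [Fd i j iF jF ij|Fd i iF].
  by move: (Fd i iF) => /forall_inP/(_ j jF)/implyP; apply.
by apply/forall_inP => j jF; apply/implyP; apply: Fd.
Qed.

Lemma card_packing (I S : finType) (h : I -> {set S}) (F : {set I}) :
  packing h F -> #|(\bigcup_(i in F) h i)%SET| = (\sum_(i in F) #|h i|)%N.
Proof.
move=> /packingP Fd; rewrite -sum1_card big_mkcond /=.
under [RHS]eq_bigr do rewrite -sum1_card big_mkcond /=.
rewrite exchange_big /=; apply: eq_bigr => x _.
case: ifPn => [/bigcupP[i iF xi]|xF].
  rewrite (bigD1 i) //= xi big1 // => j /andP[jF ji].
  by case: ifPn => // xj; move: (disjointFr (Fd _ _ jF iF ji) xj); rewrite xi.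
rewrite big1 // => i iF; case: ifPn => // xi; case/negP: xF.
by apply/bigcupP; exists i.
Qed.

(** Nonemptiness of the [h i] makes a selected member meet itself, so that the
    conclusion holds for all members of [F] alike. *)
Lemma maximal_packing (I S : finType) (h : I -> {set S}) (F : {set I}) :
  {in F, forall i, h i != finset.set0} ->
  exists F' : {set I}, [/\ F' \subset F, packing h F' &
    forall i, i \in F -> exists2 j, j \in F' & ~~ [disjoint h i & h j]].
Proof.
move=> hF; pose P (A : {set I}) := (A \subset F) && packing h A.
have [|A /maxsetP[/andP[AF pA] maxA] _] := @maxset_exists _ P finset.set0.
  rewrite /P finset.sub0set; apply/packingP => i j; rewrite inE //.
exists A; split=> // i iF; apply/exists_inP; apply: contraT => /exists_inPn nA.
have dA j : j \in A -> [disjoint h i & h j] by move=> /nA; rewrite negbK.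
have iA : i \in A.
  have <- : (i |: A)%SET = A; last by rewrite !inE eqxx.
  apply: maxA; last exact: finset.subsetUr.
  rewrite /P finset.subUset finset.sub1set iF AF /=; apply/packingP => j k.
  rewrite !inE => /ssrbool.orP[/eqP->|jA] /ssrbool.orP[/eqP->|kA] jk.
  - by rewrite eqxx in jk.
  - exact: dA.
  - by rewrite disjoint_sym; apply: dA.
  - exact: (packingP _ _ pA).
have := dA _ iA; rewrite -setI_eq0 finset.setIid => h0.
by move: (hF _ iF); rewrite h0.
Qed.

(** * Pairs, triangles and cones *)

Definition pairs_in (n : nat) (T : {set 'I_n}) : {set edge n} :=
  [set e : edge n | val e \subset T]%SET.

Lemma card_pairs_in (n : nat) (T : {set 'I_n}) : #|pairs_in T| = 'C(#|T|, 2).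
Proof.
rewrite -cards_draws -(card_imset _ val_inj); congr #|pred_of_set _|.
apply/setP => A; rewrite inE; apply/imsetP/andP.
  by move=> [e]; rewrite inE => eT ->; split=> //; apply: (valP e).
by move=> [AT A2]; exists (exist _ A A2); rewrite ?inE.
Qed.

Lemma card_edge (n : nat) : #|{: edge n}| = 'C(n, 2).
Proof.
have := card_pairs_in [set: 'I_n]%SET; rewrite finset.cardsT card_ord => <-.
rewrite -cardsT; congr #|pred_of_set _|.
by apply/setP => e; rewrite !inE finset.subsetT.
Qed.

Definition triangles (n : nat) (G : graph n) : {set {set 'I_n}} :=
  [set T : {set 'I_n} | (#|T| == 3%N) && (pairs_in T \subset G)]%SET.

Lemma card_edge_val n (e : edge n) : #|val e| = 2%N.
Proof. exact/eqP/(valP e). Qed.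

(** The triangles of [G] are recorded as three-element vertex sets; the vertices
    counted by [V_T] are those of the union of these sets. *)
Lemma V_T_cover (n : nat) (G : graph n) : V_T G = #|finset.cover (triangles G)|.
Proof.
congr #|pred_of_set _|; apply/setP => v; rewrite inE; apply/idP/bigcupP.
  move=> /existsP[u /existsP[w /and3P[]]].
  move=> /existsP[e1 /andP[e1G /eqP e1E]] /existsP[e2 /andP[e2G /eqP e2E]].
  move=> /existsP[e3 /andP[e3G /eqP e3E]].
  have vu : v != u.
    by have := card_edge_val e1; rewrite e1E cards2; case: (v == u).
  have uw : u != w.
    by have := card_edge_val e2; rewrite e2E cards2; case: (u == w).
  have wv : w != v.
    by have := card_edge_val e3; rewrite e3E cards2; case: (w == v).
  exists [set v; u; w]%SET; last by rewrite !inE eqxx.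
  rewrite inE finset.setUC cardsU1 cards2 vu !inE (negbTE wv).
  rewrite (eq_sym w u) (negbTE uw) /=.
  apply/fintype.subsetP => e; rewrite inE => /fintype.subsetP es.
  have /cards2P[i [j [ij eE]]] := valP e.
  have := es i; have := es j; rewrite eE !inE !eqxx orbT.
  move=> /(_ isT) hj /(_ isT) hi.
  suff : e = e1 \/ e = e2 \/ e = e3 by case=> [->|[->|->]].
  move: hi hj ij eE => /or3P[] /eqP -> /or3P[] /eqP ->;
    rewrite ?eqxx // => _ eE;
    first [ by left; apply: val_inj; rewrite eE e1E // finset.setUC
          | by right; left; apply: val_inj; rewrite eE e2E // finset.setUC
          | by right; right; apply: val_inj; rewrite eE e3E // finset.setUC].
move=> [T]; rewrite inE => /andP[/eqP T3 /fintype.subsetP TG] vT.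
have : #|(T :\ v)%SET| == 2%N by apply/eqP; move: (cardsD1 v T); rewrite vT T3; case.
move=> /cards2P[u [w [uw TE]]].
have uT : u \in (T :\ v)%SET by rewrite TE !inE eqxx.
have wT : w \in (T :\ v)%SET by rewrite TE !inE eqxx orbT.
move: uT wT; rewrite !inE => /andP[uv uT] /andP[wv wT].
have adjP i j : i \in T -> j \in T -> i != j -> adj G i j.
  move=> iT jT ij; have h : #|[set i; j]%SET| == 2%N by rewrite cards2 ij.
  apply/existsP; exists (exist (fun e : {set 'I_n} => #|e| == 2%N) _ h); rewrite eqxx andbT.
  apply: TG; rewrite inE /=; apply/fintype.subsetP => k.
  by rewrite !inE => /ssrbool.orP[]/eqP->.
apply/existsP; exists u; apply/existsP; exists w.
by rewrite !adjP // eq_sym.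
Qed.

(** The edges from [v] to the two ends of [e]. *)
Definition cone (n : nat) (v : 'I_n) (e : edge n) : {set edge n} :=
  (pairs_in (v |: val e) :\ e)%SET.

Lemma card_cone (n : nat) (v : 'I_n) (e : edge n) :
  v \notin val e -> #|cone v e| = 2%N.
Proof.
move=> ve; have := cardsD1 e (pairs_in (v |: val e)%SET).
rewrite card_pairs_in cardsU1 ve card_edge_val inE finset.subsetUr.
by move=> h; apply/eqP; rewrite -(eqn_add2l 1) -[X in X == _]h.
Qed.

Lemma mem_cone (n : nat) (v : 'I_n) (e e' : edge n) :
  e' \in cone v e -> v \in val e'.
Proof.
rewrite !inE => /andP[e'e /fintype.subsetP e's]; apply: contraNT e'e => ve'.
apply/eqP/val_inj/eqP; rewrite eqEcard !card_edge_val leqnn andbT.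
apply/fintype.subsetP => i ie'; move: (e's i ie'); rewrite !inE.
by case: eqP => // iv; move: ve'; rewrite -iv ie'.
Qed.

Lemma cone_sub (n : nat) (v : 'I_n) (e e' : edge n) :
  e' \in cone v e -> val e' \subset (v |: val e)%SET.
Proof. by rewrite !inE => /andP[]. Qed.

(** * Weighted sums over graphs and apex vertices *)

Definition graph_sum (R : realType) (n : nat) (x w : R) : R :=
  \sum_(G : graph n) x ^+ V_T G * w ^+ #|G|.

(** The vertex [v] completes an edge [e] of [E] to a triangle through the two
    edges of [cone v e]. *)
Definition apexes (n : nat) (E G : graph n) (v : 'I_n) : {set edge n} :=
  [set e in E | cone v e \subset G]%SET.

(** A product over the vertices outside [U] counts the triangles built on an edge
    of [E] with such an apex.  Expanding it means choosing for each vertex either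
    nothing or an edge of [E]; the chosen cones are disjoint from one another and
    from [E], so each choice of an edge costs exactly [w ^+ 2]. *)
Lemma apex_sum (R : realType) (n : nat) (x w : R) (U : {set 'I_n})
    (E : graph n) :
  0 <= x -> 0 <= w -> (forall e : edge n, e \in E -> val e \subset U) ->
  \sum_(G : graph n | E \subset G)
      w ^+ #|G| * \prod_(v | v \notin U) (1 + x * #|apexes E G v|%:R)
  <= (1 + w) ^+ #|{: edge n}| * w ^+ #|E| * (1 + #|E|%:R * (x * w ^+ 2)) ^+ n.
Proof.
move=> x0 w0 EU.
(* [None] stands for a vertex at which the term 1 of the factor is chosen. *)
pose ok v (o : option (edge n)) :=
  if o is Some e then (v \notin U) && (e \in E) else true.
pose xi v o : R := if o is None then 1 else if ok v o then x else 0.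
pose c v (o : option (edge n)) : {set edge n} :=
  if o is Some e then cone v e else finset.set0.
pose C (f : {ffun 'I_n -> option (edge n)}) := (\bigcup_v c v (f v))%SET.
have xi0 v o : 0 <= xi v o by rewrite /xi; case: o => // e; case: ifP.
have expand (G : graph n) :
    \prod_(v | v \notin U) (1 + x * #|apexes E G v|%:R)
    = \sum_(f : {ffun 'I_n -> option (edge n)})
        (\prod_v xi v (f v)) * (C f \subset G)%:R.
  transitivity (\prod_v \sum_o xi v o * (c v o \subset G)%:R).
    rewrite big_mkcond; apply: eq_bigr => v _.
    rewrite big_option /= finset.sub0set mulr1 /xi /=.
    case: ifPn => vU; last first.
      by rewrite big1 ?addr0 // => e _; rewrite mul0r.
    congr (1 + _); rewrite /apexes -sum1_card natr_sum mulr_sumr big_mkcond /=.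
    apply: eq_bigr => e _; rewrite inE; case: (e \in E) => /=; last first.
      by rewrite mul0r.
    by case: (cone v e \subset G); rewrite ?mulr1 ?mulr0.
  rewrite bigA_distr_bigA; apply: eq_bigr => f _; rewrite big_split /=.
  congr (_ * _); case: (boolP (C f \subset G)) => [/finset.bigcupsP CG|].
    by rewrite big1 // => v _; rewrite CG.
  move=> /fintype.subsetPn[e /bigcupP[v _ ev] eG].
  rewrite (bigD1 v) //=; have -> : (c v (f v) \subset G) = false.
    by apply/negbTE/fintype.subsetPn; exists e.
  by rewrite mul0r.
have term (f : {ffun 'I_n -> option (edge n)}) :
    \sum_(G : graph n | E \subset G)
      w ^+ #|G| * ((\prod_v xi v (f v)) * (C f \subset G)%:R)
    <= (1 + w) ^+ #|{: edge n}| * w ^+ #|E|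
       * \prod_v (xi v (f v) * w ^+ (if f v is Some _ then 2 else 0)).
  case: (boolP [forall v, ok v (f v)]) => [/forallP okf|]; last first.
    rewrite negb_forall => /existsP[v okv].
    have x00 : xi v (f v) = 0.
      by move: okv; rewrite /xi; case: (f v) => // e /negbTE ->.
    rewrite big1 => [|G _]; last by rewrite (bigD1 v) //= x00 !mul0r mulr0.
    by rewrite (bigD1 v) //= x00 !mul0r mulr0.
  (* An edge of a cone contains its apex, which lies outside [U]. *)
  have cardC : #|(E :|: C f)%SET|
      = (#|E| + \sum_v (if f v is Some _ then 2 else 0))%N.
    rewrite cardsU; have -> : (E :&: C f)%SET = finset.set0.
      apply/setP => e; rewrite !inE; apply/negP => /andP[eE /bigcupP[v _]].
      have := okf v; rewrite /c /ok; case: (f v) => [e' /andP[vU _]|].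
        move=> /mem_cone ve; move/fintype.subsetP: (EU e eE) => /(_ v ve).
        by rewrite (negbTE vU).
      by rewrite inE.
    rewrite cards0 subn0; congr (_ + _)%N.
    have pC : packing (fun v => c v (f v)) [set: 'I_n]%SET.
      apply/packingP => u v _ _ uv; rewrite -setI_eq0; apply/eqP/setP => e.
      rewrite !inE; apply/negP => /andP[].
      have := okf u; have := okf v; rewrite /c /ok.
      case: (f u) => [e1|]; last by rewrite inE.
      case: (f v) => [e2|]; last by rewrite !inE.
      move=> /andP[vU e2E] /andP[uU e1E] /cone_sub/fintype.subsetP h1.
      move=> /mem_cone /h1; rewrite !inE eq_sym (negbTE uv) /=.
      by move/fintype.subsetP: (EU e1 e1E) => h /h; rewrite (negbTE vU).
    have -> : C f = (\bigcup_(v in [set: 'I_n]) c v (f v))%SET.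
      by apply: eq_bigl => v; rewrite inE.
    rewrite card_packing //; under eq_bigl do rewrite inE.
    apply: eq_bigr => v _; have := okf v; rewrite /c /ok.
    case: (f v) => [e /andP[vU eE]|_]; last by rewrite cards0.
    rewrite card_cone //; apply: contra vU.
    by move: (EU e eE) => /fintype.subsetP; apply.
  rewrite big_split /= prodrXr.
  have -> : \sum_(G : graph n | E \subset G)
      w ^+ #|G| * ((\prod_v xi v (f v)) * (C f \subset G)%:R)
    = (\prod_v xi v (f v)) * \sum_(G : graph n | (E :|: C f)%SET \subset G)
      w ^+ #|G|.
    rewrite mulr_sumr [LHS]big_mkcond [RHS]big_mkcond /=.
    apply: eq_bigr => G _; rewrite finset.subUset.
    by case: (E \subset G) => //=; case: (C f \subset G) => /=; rewrite ?mulr0 // mulr1 mulrC.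
  rewrite mulrCA -mulrA; apply: ler_wpM2l; first exact: prodr_ge0.
  by rewrite -exprD -cardC; apply: sum_supersets_le.
under eq_bigr do rewrite expand mulr_sumr.
rewrite exchange_big /=; apply: le_trans (ler_sum _ (fun f _ => term f)) _.
rewrite -mulr_sumr; apply: ler_wpM2l.
  by rewrite mulr_ge0 ?exprn_ge0 // addr_ge0.
rewrite -(bigA_distr_bigA (fun v o =>
  xi v o * w ^+ (if o is Some _ then 2 else 0))) /=.
have -> : (1 + #|E|%:R * (x * w ^+ 2)) ^+ n
    = \prod_(v : 'I_n) (1 + #|E|%:R * (x * w ^+ 2)).
  by rewrite prodr_const card_ord.
apply: ler_prod => v _; apply/andP; split.
  by apply: sumr_ge0 => o _; rewrite mulr_ge0 // exprn_ge0.
rewrite big_option /= mulr1 lerD2l -sum1_card natr_sum mulr_suml.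
rewrite [leRHS]big_mkcond /=; apply: ler_sum => e _.
case: (v \notin U) => /=; case: (e \in E) => /=; rewrite ?mul1r ?mul0r //.
by rewrite mulr_ge0 ?exprn_ge0.
Qed.

(** * Families of triples *)

Definition triples (n : nat) : {set {set 'I_n}} :=
  [set T : {set 'I_n} | #|T| == 3%N]%SET.

Definition shadow (n : nat) (F : {set {set 'I_n}}) : {set edge n} :=
  (\bigcup_(T in F) pairs_in T)%SET.

Definition vertex_packing (n : nat) (F : {set {set 'I_n}}) : bool :=
  (F \subset triples n) && packing id F.

Definition packing_sum (R : realType) (n : nat) (z : R) : R :=
  \sum_(F : {set {set 'I_n}} | vertex_packing F) z ^+ #|F|.

Lemma card_triples_le (n : nat) : (#|triples n| <= n ^ 3)%N.
Proof.
have -> : triples n =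
    [set A : {set 'I_n} | A \subset [set: 'I_n]%SET & #|A| == 3%N]%SET.
  by apply/setP => A; rewrite !inE finset.subsetT.
rewrite cards_draws finset.cardsT card_ord.
apply: (@leq_trans (n ^_ 3)).
  by rewrite -bin_ffact leq_pmulr // fact_gt0.
by rewrite !ffactnS ffactn0 muln1 !expnS expn0 muln1 !leq_mul ?leq_pred //;
   exact: leq_trans (leq_pred _) (leq_pred _).
Qed.

Lemma card_cover_packing (n : nat) (F : {set {set 'I_n}}) :
  vertex_packing F -> #|finset.cover F| = (3 * #|F|)%N.
Proof.
move=> /andP[/fintype.subsetP Ft pF]; rewrite /finset.cover (card_packing pF).
rewrite (eq_bigr (fun=> 3%N)) => [|T /Ft]; last by rewrite inE => /eqP.
by rewrite sum_nat_const mulnC.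
Qed.

Lemma card_shadow (n : nat) (F : {set {set 'I_n}}) :
  F \subset triples n -> packing (@pairs_in n) F -> #|shadow F| = (3 * #|F|)%N.
Proof.
move=> /fintype.subsetP Ft pF; rewrite /shadow (card_packing pF).
rewrite (eq_bigr (fun=> 3%N)) => [|T /Ft]; last first.
  by rewrite inE card_pairs_in => /eqP ->.
by rewrite sum_nat_const mulnC.
Qed.

Lemma triangles_triples (n : nat) (G : graph n) : triangles G \subset triples n.
Proof. by apply/fintype.subsetP => T; rewrite !inE => /andP[]. Qed.

Lemma subset_triangles (n : nat) (G : graph n) (F : {set {set 'I_n}}) :
  (F \subset triangles G) = (F \subset triples n) && (shadow F \subset G).
Proof.
apply/idP/andP => [FG|[/fintype.subsetP Ft /finset.bigcupsP FG]].
  split; first exact: fintype.subset_trans FG (triangles_triples G).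
  apply/finset.bigcupsP => T /(fintype.subsetP FG).
  by rewrite inE => /andP[].
apply/fintype.subsetP => T TF; move: (Ft T TF); rewrite !inE => ->.
exact: FG.
Qed.

Lemma pairs_in_neq0 (n : nat) (T : {set 'I_n}) :
  T \in triples n -> pairs_in T != finset.set0.
Proof. by rewrite inE -card_gt0 card_pairs_in => /eqP ->. Qed.

(** * Upper bound for the normalising sum *)

(** By maximality, a triangle at a vertex [v] not covered by [F] shares an edge
    with a member of [F].  That edge avoids [v], so [v] is an apex over it. *)
Lemma exp_V_T_le_apexes (R : realType) (n : nat) (x : R) (G : graph n)
    (F : {set {set 'I_n}}) :
  1 <= x -> F \subset triangles G ->
  (forall T, T \in triangles G ->
     exists2 S, S \in F & ~~ [disjoint pairs_in T & pairs_in S]) ->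
  x ^+ V_T G <= x ^+ #|finset.cover F| *
    \prod_(v | v \notin finset.cover F) (1 + x * #|apexes (shadow F) G v|%:R).
Proof.
move=> x1 FG maxF; have x0 : 0 <= x by apply: le_trans x1.
rewrite V_T_cover -!prodr_const.
rewrite [X in _ <= X * _]big_mkcond [X in _ <= _ * X]big_mkcond -big_split /=.
rewrite [leLHS]big_mkcond /=; apply: ler_prod => v _.
have k0 : 0 <= x * #|apexes (shadow F) G v|%:R by rewrite mulr_ge0.
case: (boolP (v \in finset.cover F)) => vF /=.
  by rewrite mulr1; case: ifP => _; rewrite ?x0 ?lexx ?ler01 ?x1.
rewrite mul1r; case: ifPn => [/bigcupP[T TG vT]|_]; last by rewrite ler01 lerDl.
rewrite x0 /=; suff : (0 < #|apexes (shadow F) G v|)%N.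
  rewrite -(ler_nat R) => k1; apply: (@le_trans _ _ (x * 1)); first by rewrite mulr1.
  by rewrite ler_wpDl // ler_wpM2l.
have [S SF] := maxF T TG; rewrite -setI_eq0 => /set0Pn[e]; rewrite finset.inE.
rewrite !inE in TG *; move=> /andP[eT eS].
move: TG => /andP[T3 /fintype.subsetP TG].
apply/card_gt0P; exists e; rewrite inE; apply/andP; split.
  by apply/bigcupP; exists S => //; rewrite inE.
apply/fintype.subsetP => e' /cone_sub e's; apply: TG; rewrite inE.
by apply: (fintype.subset_trans e's); rewrite finset.subUset finset.sub1set vT.
Qed.

(** Each graph is charged to a maximal family of edge-disjoint triangles in it.
    The apex factor is at most [(1 + 3 |F| x w^2)^n], which an exponential turns
    into a factor per member of [F], even though [F] may have order [n^2] members. *)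
Lemma graph_sum_le_edge_packings (R : realType) (n : nat) (x w : R) :
  1 <= x -> 0 <= w ->
  graph_sum n x w <= (1 + w) ^+ #|{: edge n}| *
    \sum_(F : {set {set 'I_n}} | F \subset triples n)
       x ^+ #|finset.cover F| * (w ^+ 3 * expR (3 * n%:R * x * w ^+ 2)) ^+ #|F|.
Proof.
move=> x1 w0; have x0 : 0 <= x by apply: le_trans x1.
pose P (F : {set {set 'I_n}}) :=
  (F \subset triples n) && packing (@pairs_in n) F.
pose term (F : {set {set 'I_n}}) (G : graph n) : R := x ^+ #|finset.cover F| *
  (w ^+ #|G| * \prod_(v | v \notin finset.cover F)
    (1 + x * #|apexes (shadow F) G v|%:R)).
have term0 F G : 0 <= term F G.
  rewrite !mulr_ge0 ?exprn_ge0 // prodr_ge0 // => v _.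
  by rewrite addr_ge0 // mulr_ge0.
apply: (@le_trans _ _ (\sum_(G : graph n)
    \sum_(F | P F && (shadow F \subset G)) term F G)).
  apply: ler_sum => G _.
  have [|F [FG pF maxF]] := @maximal_packing _ _ (@pairs_in n) (triangles G).
    move=> T /(fintype.subsetP (triangles_triples G)); exact: pairs_in_neq0.
  rewrite (bigD1 F) /=; last by rewrite /P pF andbT -subset_triangles.
  rewrite -[leLHS]addr0; apply: lerD; last by apply: sumr_ge0 => F' _.
  rewrite /term mulrCA [leLHS]mulrC; apply: ler_wpM2l; first exact: exprn_ge0.
  exact: exp_V_T_le_apexes.
rewrite (exchange_big_dep P) /=; last by move=> G F _ /andP[].
rewrite mulr_sumr [leRHS](bigID (packing (@pairs_in n))) /=.
rewrite -[leLHS]addr0; apply: lerD; last first.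
  apply: sumr_ge0 => F _; rewrite !mulr_ge0 ?exprn_ge0 ?addr_ge0 // mulr_ge0 //.
  by rewrite exprn_ge0 // expR_ge0.
apply: ler_sum => F /andP[Ft pF].
rewrite (eq_bigl (fun G : graph n => shadow F \subset G)); last first.
  by move=> G; rewrite /P Ft pF.
rewrite /term -mulr_sumr mulrCA; apply: ler_wpM2l; first exact: exprn_ge0.
apply: le_trans (apex_sum _ _ _) _ => //.
  move=> e /bigcupP[T TF]; rewrite inE => /fintype.subset_trans; apply.
  exact: finset.bigcup_sup.
rewrite -mulrA; apply: ler_wpM2l; first by rewrite exprn_ge0 // addr_ge0.
rewrite card_shadow // exprMn -exprM; apply: ler_wpM2l; first exact: exprn_ge0.
rewrite -expRM_natl; set k := #|F|.
apply: (@le_trans _ _ (expR ((3 * k)%:R * (x * w ^+ 2)) ^+ n)).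
  apply: lerXn2r; rewrite ?nnegrE ?expR_ge0 //; last exact: expR_ge1Dx.
  by rewrite addr_ge0 // !mulr_ge0 // exprn_ge0.
rewrite -expRM_natl ler_expR natrM.

have -> : n%:R * (3%:R * k%:R * (x * w ^+ 2)) = k%:R * (3 * n%:R * x * w ^+ 2) :> R by ring.
by [].
Qed.

(** A member of [F] outside [P] meets a member of [P], so it covers at most two
    vertices that [P] leaves uncovered. *)
Lemma card_cover_le (n : nat) (F P : {set {set 'I_n}}) :
  F \subset triples n -> P \subset F ->
  (forall T, T \in F -> exists2 S, S \in P & ~~ [disjoint T & S]) ->
  (#|finset.cover F| <= 3 * #|P| + 2 * #|(F :\: P)%SET|)%N.
Proof.
move=> /fintype.subsetP Ft PF maxP.
have -> : finset.cover F = (finset.cover P :|: (finset.cover F :\: finset.cover P))%SET.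
  apply/setP => v; rewrite !inE; case: (boolP (v \in finset.cover P)) => //=.
  move=> /bigcupP[T TP vT]; apply/bigcupP; exists T => //.
  exact: (fintype.subsetP PF).
have card3 T : T \in F -> #|T| = 3%N by move=> /Ft; rewrite inE => /eqP.
apply: leq_trans (leq_card_setU _ _) _; apply: leq_add.
  apply: leq_trans (leq_card_cover P) _; rewrite mulnC -sum_nat_const.
  by apply: leq_sum => T TP; rewrite card3 // (fintype.subsetP PF).
rewrite mulnC -sum_nat_const.
apply: (@leq_trans (\sum_(T in F :\: P) #|T :\: finset.cover P|)%N); last first.
  apply: leq_sum => T; rewrite !inE => /andP[_ TF].
  have [S SP] := maxP T TF; rewrite -setI_eq0 => /set0Pn[v].
  rewrite finset.inE => /andP[vT vS].
  rewrite -ltnS -(card3 T TF) (cardsD1 v T) vT add1n ltnS subset_leq_card //.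
  apply/fintype.subsetP => u; rewrite !inE => /andP[uP ->]; rewrite andbT.
  by apply: contra uP => /eqP ->; apply/bigcupP; exists S.
apply: (@leq_trans #|(\bigcup_(T in F :\: P) (T :\: finset.cover P))%SET|).
  apply: subset_leq_card; apply/fintype.subsetP => v.
  rewrite finset.inE => /andP[vP /bigcupP[T TF vT]].
  apply/bigcupP; exists T; rewrite !inE ?vP //= TF andbT.
  by apply: contra vP => TP; apply/bigcupP; exists T.
by elim/big_rec2: _ => [|T k A _ IH];
  rewrite ?cards0 // (leq_trans (leq_card_setU _ _)) // leq_add2l.
Qed.

(** Every family consists of a maximal disjoint subfamily [P], weighing [x^3 q]
    per member, and of further triples, weighing at most [x^2 q] each; the latter
    are summed freely over all triples. *)
Lemma sum_cover_le (R : realType) (n : nat) (x q : R) :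
  1 <= x -> 0 <= q ->
  \sum_(F : {set {set 'I_n}} | F \subset triples n)
     x ^+ #|finset.cover F| * q ^+ #|F|
  <= packing_sum n (x ^+ 3 * q) * (1 + x ^+ 2 * q) ^+ (n ^ 3).
Proof.
move=> x1 q0; have x0 : 0 <= x by apply: le_trans x1.
pose term (F P : {set {set 'I_n}}) : R :=
  (x ^+ 3 * q) ^+ #|P| * (x ^+ 2 * q) ^+ #|(F :\: P)%SET|.
have term0 F P : 0 <= term F P by rewrite !mulr_ge0 ?exprn_ge0 ?mulr_ge0 ?exprn_ge0.
apply: (@le_trans _ _ (\sum_(F : {set {set 'I_n}} | F \subset triples n)
    \sum_(P | vertex_packing P && (P \subset F)) term F P)).
  apply: ler_sum => F Ft.
  have [|P [PF pP maxP]] := @maximal_packing _ _ id F.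
    move=> T /(fintype.subsetP Ft); rewrite inE -card_gt0 => /eqP -> //.
  rewrite (bigD1 P) /=; last by rewrite /vertex_packing pP PF (fintype.subset_trans PF).
  rewrite -[leLHS]addr0; apply: lerD; last by apply: sumr_ge0 => F' _.
  have cF : #|F| = (#|P| + #|(F :\: P)%SET|)%N.
    by rewrite cardsD (finset.setIidPr PF) subnKC // subset_leq_card.
  rewrite /term (exprMn _ (x ^+ 3) q) (exprMn _ (x ^+ 2) q) -!(exprM x) cF exprD mulrACA -(exprD q).
  rewrite -exprD; apply: ler_wpM2r; first by rewrite exprn_ge0.
  by rewrite ler_weXn2l // card_cover_le.
rewrite (exchange_big_dep (@vertex_packing n)) /=; last by move=> F P _ /andP[].
rewrite /packing_sum mulr_suml; apply: ler_sum => P vP.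
rewrite /term -mulr_sumr; apply: ler_wpM2l.
  by rewrite exprn_ge0 // mulr_ge0 ?exprn_ge0.
rewrite (eq_bigl (fun F : {set {set 'I_n}} => (P \subset F) && (F \subset triples n))); last first.
  by move=> F; rewrite vP andbC.
rewrite sum_interval; last by case/andP: vP.
apply: ler_weXn2l; first by rewrite lerDl mulr_ge0 ?exprn_ge0.
apply: leq_trans (card_triples_le n).
by apply: subset_leq_card; rewrite finset.subsetDl.
Qed.

Lemma card_packing_le (n : nat) (F : {set {set 'I_n}}) :
  vertex_packing F -> (3 * #|F| <= n)%N.
Proof.
by move=> vF; rewrite -card_cover_packing // -[leqRHS]card_ord max_card.
Qed.

(** In the intended range [x^3 ~ n] and [n w = O(1)], so that [n y] has order
    [n^(1/3)] and the second exponent has order [n^(2/3)]. *)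
Lemma graph_sum_le (R : realType) (n : nat) (x w : R) :
  1 <= x -> 0 <= w -> forall y, y = 3 * n%:R * x * w ^+ 2 ->
  graph_sum n x w <= (1 + w) ^+ #|{: edge n}| *
    expR (n%:R * y + n%:R ^+ 3 * (x ^+ 2 * w ^+ 3 * expR y)) *
    packing_sum n (x ^+ 3 * w ^+ 3).
Proof.
move=> x1 w0 y yE; have x0 : 0 <= x by apply: le_trans x1.
have y0 : 0 <= y by rewrite yE !mulr_ge0 ?exprn_ge0.
have q0 : 0 <= w ^+ 3 * expR y by rewrite mulr_ge0 ?exprn_ge0 ?expR_ge0.
apply: le_trans (graph_sum_le_edge_packings n x1 w0) _; rewrite -yE.
rewrite -mulrA; apply: ler_wpM2l; first by rewrite exprn_ge0 // addr_ge0.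
apply: le_trans (sum_cover_le n x1 q0) _.
rewrite expRD [leRHS]mulrAC; apply: ler_pM.
- by apply: sumr_ge0 => P _; rewrite exprn_ge0 // mulr_ge0 ?exprn_ge0.
- by rewrite exprn_ge0 // addr_ge0 // mulr_ge0 ?exprn_ge0.
- rewrite /packing_sum mulr_sumr; apply: ler_sum => P vP.
  rewrite mulrA exprMn mulrC; apply: ler_wpM2r.
    by rewrite exprn_ge0 // mulr_ge0 ?exprn_ge0.
  rewrite -expRM_natl ler_expR ler_wpM2r // ler_nat.
  by apply: leq_trans (card_packing_le vP); rewrite leq_pmull.
rewrite -natrX expRM_natl mulrA lerXn2r ?nnegrE ?expR_ge0 ?expR_ge1Dx //.
by rewrite addr_ge0 // !mulr_ge0 ?exprn_ge0 ?expR_ge0.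
Qed.

(** * Lower bound for the normalising sum *)

Lemma vertex_packing_pairs (n : nat) (P : {set {set 'I_n}}) :
  vertex_packing P -> packing (@pairs_in n) P.
Proof.
move=> /andP[_ /packingP pP]; apply/packingP => S T SP TP ST.
rewrite -setI_eq0; apply/eqP/setP => e; rewrite !inE; apply/negP => /andP[eS eT].
have : (0 < #|val e|)%N by rewrite card_edge_val.
move=> /card_gt0P[v ve]; have vS := fintype.subsetP eS v ve.
by have := disjointFr (pP S T SP TP ST) vS; rewrite (fintype.subsetP eT v ve).
Qed.

Lemma card_shadow_packing (n : nat) (P : {set {set 'I_n}}) :
  vertex_packing P -> #|shadow P| = (3 * #|P|)%N.
Proof.
by move=> vP; rewrite card_shadow ?vertex_packing_pairs //; case/andP: vP.
Qed.

(** Two pairs inside a triple share a vertex.  If they lay in members of a family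
    of disjoint triples, these members would coincide and equal the triple. *)
Lemma card_pairs_shadow_le1 (n : nat) (P : {set {set 'I_n}}) (T : {set 'I_n}) :
  vertex_packing P -> T \in triples n -> T \notin P ->
  (#|(pairs_in T :&: shadow P)%SET| <= 1)%N.
Proof.
move=> /andP[/fintype.subsetP Pt /packingP pP]; rewrite inE => /eqP T3.
apply: contraR; rewrite -ltnNge => /card_gt1P[e [f []]].
rewrite !finset.in_setI => /andP[eT /bigcupP[A AP eA]] /andP[fT /bigcupP[B BP fB]].
move: eT fT eA fB; rewrite !inE => eT fT eA fB ef.
have cU : (2 < #|(val e :|: val f)%SET|)%N.
  rewrite -{1}(card_edge_val e); apply: proper_card.
  rewrite properE finset.subsetUl /=; apply: contra ef => sef.
  apply/eqP/esym/val_inj/eqP; rewrite eqEcard !card_edge_val leqnn andbT.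
  exact: fintype.subset_trans (finset.subsetUr _ _) sef.
have UT : (val e :|: val f)%SET = T.
  by apply/eqP; rewrite eqEcard finset.subUset eT fT T3.
suff AB : A = B.
  suff -> : T = A by [].
  apply/eqP; rewrite eqEcard -{1}UT finset.subUset eA AB fB T3.
  by move: (Pt B BP); rewrite inE => /eqP ->.
apply: contraTeq isT => /(pP A B AP BP) AB.
have dI : (val e :&: val f)%SET = finset.set0.
  by apply/eqP; rewrite setI_eq0; apply: disjointW AB.
by have := cardsUI (val e) (val f); rewrite UT dI cards0 T3 !card_edge_val.
Qed.

Lemma card_triples_over (n : nat) (e : edge n) :
  (#|[set T in triples n | e \in pairs_in T]%SET| <= n)%N.
Proof.
rewrite -[X in (_ <= X)%N]card_ord -cardsT.
apply: (@leq_trans #|((fun v => v |: val e)%SET @: [set: 'I_n])%SET|); last first.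
  exact: leq_imset_card.
apply: subset_leq_card; apply/fintype.subsetP => T.
rewrite !inE => /andP[/eqP T3 eT].
have : #|(T :\: val e)%SET| == 1%N.
  by rewrite cardsD (finset.setIidPr eT) T3 card_edge_val.
move=> /cards1P[v Tv]; apply/imsetP; exists v; rewrite ?inE //.
by rewrite -Tv finset.setUC -{1}(finset.setIidPr eT) finset.setID.
Qed.

Lemma expr_sub3_le (R : realType) (w : R) (k : nat) :
  0 <= w -> (k <= 1)%N -> w ^+ (3 - k) <= w ^+ 3 + k%:R * w ^+ 2.
Proof.
move=> w0; case: k => [|[|//]] _; first by rewrite mul0r addr0.
by rewrite mul1r lerDr exprn_ge0.
Qed.

(** Given the triangles of [P], a further triple needs either three new edges, and
    there are at most [n^3] triples, or two new edges, in which case it contains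
    one of the at most [n] pairs of [shadow P] and a third vertex. *)
Lemma mean_extra_triangles (R : realType) (n : nat) (w : R)
    (P : {set {set 'I_n}}) :
  0 <= w -> vertex_packing P ->
  \sum_(G : graph n | shadow P \subset G)
     w ^+ #|G| * #|(triangles G :\: P)%SET|%:R
  <= w ^+ #|shadow P| * (1 + w) ^+ #|(~: shadow P)%SET|
     * (n%:R ^+ 3 * w ^+ 3 + n%:R ^+ 2 * w ^+ 2).
Proof.
move=> w0 vP; set H := shadow P.
have w10 : 0 <= 1 + w by rewrite addr_ge0.
apply: (@le_trans _ _ (\sum_(T in triples n :\: P)
    \sum_(G : graph n | (H :|: pairs_in T)%SET \subset G) w ^+ #|G|)).
  rewrite (exchange_big_dep (fun G : graph n => H \subset G)) /=; last first.
    by move=> T G _; rewrite finset.subUset => /andP[].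
  rewrite le_eqVlt; apply/ssrbool.orP; left; apply/eqP; apply: eq_bigr => G HG.
  rewrite -[#|(triangles G :\: P)%SET|]sum1_card natr_sum mulr_sumr big_mkcond [RHS]big_mkcond /=.
  apply: eq_bigr => T _; rewrite !inE finset.subUset HG mulr1 /=.
  by case: (T \in P); case: (#|T| == 3%N); case: (pairs_in T \subset G).
have bound T : T \in (triples n :\: P)%SET ->
    \sum_(G : graph n | (H :|: pairs_in T)%SET \subset G) w ^+ #|G|
    <= w ^+ #|H| * (1 + w) ^+ #|(~: H)%SET| *
       (w ^+ 3 + #|(pairs_in T :&: H)%SET|%:R * w ^+ 2).
  rewrite finset.inE => /andP[TP Tt].
  have T3 : #|pairs_in T| = 3%N.
    by move: Tt; rewrite inE card_pairs_in => /eqP ->.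
  have cU : #|(H :|: pairs_in T)%SET|
      = (#|H| + (3 - #|(pairs_in T :&: H)%SET|))%N.
    rewrite cardsU finset.setIC T3 addnBA //.
    by rewrite -T3 subset_leq_card // finset.subsetIl.
  rewrite sum_supersets cU exprD -!mulrA; apply: ler_wpM2l.
    exact: exprn_ge0.
  rewrite mulrC; apply: ler_pM; rewrite ?exprn_ge0 //.
    rewrite ler_weXn2l ?lerDl // subset_leq_card // finset.setCS.
    exact: finset.subsetUl.
  by rewrite expr_sub3_le // card_pairs_shadow_le1.
apply: le_trans (ler_sum _ bound) _; rewrite -mulr_sumr; apply: ler_wpM2l.
  by rewrite mulr_ge0 ?exprn_ge0.
rewrite big_split /= sumr_const -[X in X + _]mulr_natl -mulr_suml; apply: lerD.
  rewrite ler_wpM2r ?exprn_ge0 // -natrX ler_nat.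
  apply: leq_trans (card_triples_le n); apply: subset_leq_card.
  exact: finset.subsetDl.
rewrite ler_wpM2r ?exprn_ge0 // -natr_sum -natrX ler_nat.
apply: (@leq_trans (\sum_(e in H) n)%N); last first.
  rewrite sum_nat_const card_shadow_packing // -mulnn leq_mul2r.
  by rewrite card_packing_le ?orbT.
apply: (@leq_trans (\sum_(T in triples n) \sum_(e in H | e \in pairs_in T) 1)%N).
  rewrite [X in (X <= _)%N]big_mkcond [X in (_ <= X)%N]big_mkcond /=.
  apply: leq_sum => T _; rewrite finset.inE; case: (T \in P) => //=.
  case: (T \in triples n) => //; rewrite sum1dep_card subset_leq_card //.
  by apply/fintype.subsetP => e; rewrite !finset.in_setI !inE andbC.
rewrite (exchange_big_dep (fun e => e \in H)) /=; last by move=> T e _ /andP[].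
apply: leq_sum => e eH; rewrite sum1dep_card.
apply: leq_trans (card_triples_over e); apply: subset_leq_card.
by apply/fintype.subsetP => T; rewrite !inE eH.
Qed.

(** A form of Markov's inequality that can be summed directly: for [k <= K] the
    left side is at most [c ^+ K], otherwise it is not positive. *)
Lemma expr_ge_affine (R : realFieldType) (c : R) (K k : nat) :
  0 < c <= 1 -> (0 < K)%N -> c ^+ K * (1 - k%:R / K%:R) <= c ^+ k.
Proof.
move=> /andP[c0 c1] K0; have K0' : 0 < K%:R :> R by rewrite ltr0n.
have [kK|Kk] := leqP k K.
  apply: (@le_trans _ _ (c ^+ K)).
    by rewrite ler_piMr ?gerBl ?divr_ge0 // exprn_ge0 // ltW.
  by rewrite ler_wiXn2l // ltW.
apply: (@le_trans _ _ 0); last by rewrite exprn_ge0 // ltW.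
rewrite mulr_ge0_le0 ?exprn_ge0 ?ltW // subr_lt0 ltr_pdivlMr // mul1r.
by rewrite ltr_nat.
Qed.

(** A graph is distributed over the subfamilies [P] of its triangles with weight
    [d ^+ k] for [k] triangles left out, which has total [(1 + d) ^+ #|triangles G|].
    The factor [d / (1 + d)] for each omitted triangle is harmless because the
    mean number of these is at most [K / 2].  For [d = 1 / n] all corrections are
    polynomial in [n]. *)
Lemma graph_sum_ge (R : realType) (n K : nat) (x w d : R) :
  1 <= x -> 0 <= w -> 0 < d -> (0 < K)%N ->
  2 * (n%:R ^+ 3 * w ^+ 3 + n%:R ^+ 2 * w ^+ 2) <= K%:R ->
  (1 + w) ^+ #|{: edge n}| * (d / (1 + d)) ^+ K *
     packing_sum n (x ^+ 3 * w ^+ 3)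
  <= 2 * (1 + d) ^+ n * (1 + w) ^+ n * graph_sum n x w.
Proof.
move=> x1 w0 d0 K0 hK; have x0 : 0 <= x by apply: le_trans x1.
set c := d / (1 + d).
have d10 : 0 < 1 + d by rewrite addr_gt0.
have c0 : 0 < c by rewrite divr_gt0.
have c1 : c <= 1 by rewrite ler_pdivrMr // mul1r lerDr.
have w10 : 0 <= 1 + w by rewrite addr_ge0.
have K0' : 0 < K%:R :> R by rewrite ltr0n.
(* Given [shadow P], at least half of the weight survives the factor [c ^+ k]. *)
have one_packing P : vertex_packing P ->
    w ^+ #|shadow P| * (1 + w) ^+ #|(~: shadow P)%SET| * c ^+ K
    <= 2 * \sum_(G : graph n | shadow P \subset G)
             w ^+ #|G| * c ^+ #|(triangles G :\: P)%SET|.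
  move=> vP; set S := w ^+ _ * _.
  have S0 : 0 <= S by rewrite mulr_ge0 ?exprn_ge0.
  have mean := mean_extra_triangles w0 vP; rewrite -/S in mean.
  apply: (@le_trans _ _ (2 * (c ^+ K * (S - K%:R^-1 *
     \sum_(G : graph n | shadow P \subset G)
        w ^+ #|G| * #|(triangles G :\: P)%SET|%:R)))).
    rewrite [leLHS]mulrC [leRHS]mulrCA; apply: ler_wpM2l.
      by rewrite exprn_ge0 // ltW.
    set M := \sum_(G | _) _ in mean *; set q := _ + _ in hK mean.
    have : K%:R^-1 * M <= S / 2.
      rewrite mulrC ler_pdivrMr //; apply: (le_trans mean).
      by rewrite -[S / 2 * _]mulrA ler_wpM2l // ler_pdivlMl.
    lra.
  apply: ler_wpM2l => //; rewrite /S -sum_supersets mulr_sumr -sumrB mulr_sumr.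
  apply: ler_sum => G _; set k := #|(triangles G :\: P)%SET|.
  have -> (a b q r : R) : a * (b - q * (b * r)) = b * (a * (1 - r * q)).
    by ring.
  by rewrite ler_wpM2l ?exprn_ge0 // expr_ge_affine // c0.
have weight (G : graph n) :
    \sum_(P | vertex_packing P && (shadow P \subset G))
      x ^+ (3 * #|P|) * (w ^+ #|G| * c ^+ #|(triangles G :\: P)%SET|)
    <= (1 + d) ^+ n * (x ^+ V_T G * w ^+ #|G|).
  apply: (@le_trans _ _ (\sum_(P : {set {set 'I_n}} | P \subset triangles G)
    (1 + d) ^+ n * (x ^+ V_T G * w ^+ #|G|) *
      (d ^+ #|(triangles G :\: P)%SET| / (1 + d) ^+ #|triangles G|))).
    rewrite [leRHS](bigID (fun P => vertex_packing P)) /=.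
    rewrite -[leLHS]addr0; apply: lerD; last first.
      apply: sumr_ge0 => P _; rewrite !mulr_ge0 ?invr_ge0 ?exprn_ge0 //;
        exact: ltW.
    rewrite (eq_bigl (fun P : {set {set 'I_n}} =>
      (P \subset triangles G) && vertex_packing P)); last first.
      move=> P; rewrite subset_triangles andbC.
      by case: (boolP (vertex_packing P)) => [/andP[-> _]|]; rewrite ?andbF.
    apply: ler_sum => P /andP[PG vP].
    have -> : #|triangles G| = (#|(triangles G :\: P)%SET| + #|P|)%N.
      by rewrite cardsD (finset.setIidPr PG) subnK // subset_leq_card.
    rewrite /c expr_div_n exprD; set k := #|(_ :\: _)%SET|.
    set D := 1 + d in d10 *.
    have alg (a b q r e f : R) : e != 0 -> f != 0 ->
        a * (b * q) * (r / (e * f)) = a / f * (b * (q * (r / e))).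
      by move=> e0 f0; field; rewrite ?e0 ?f0.
    rewrite alg ?expf_neq0 ?gt_eqF //.
    have wk0 : 0 <= w ^+ #|G| * (d ^+ k / D ^+ k).
      by rewrite !mulr_ge0 ?invr_ge0 ?exprn_ge0 //; exact: ltW.
    rewrite -[leLHS]mul1r; apply: ler_pM => //.
    - by rewrite mulr_ge0 ?exprn_ge0.
    - rewrite ler_pdivlMr ?exprn_gt0 // mul1r ler_weXn2l ?lerDl ?ltW //.
      by apply: leq_trans (card_packing_le vP); rewrite leq_pmull.
    rewrite ler_wpM2r // ler_weXn2l // -card_cover_packing // V_T_cover.
    apply: subset_leq_card; apply/finset.bigcupsP => T TP.
    by apply: finset.bigcup_sup; apply: (fintype.subsetP PG).
  rewrite -mulr_sumr -mulr_suml sum_subset_complements divff ?mulr1 //.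
  by rewrite expf_neq0 // gt_eqF.
rewrite /packing_sum mulr_sumr.
apply: (@le_trans _ _ (2 * (1 + w) ^+ n * \sum_(P | vertex_packing P)
   \sum_(G : graph n | shadow P \subset G)
      x ^+ (3 * #|P|) * (w ^+ #|G| * c ^+ #|(triangles G :\: P)%SET|))).
  rewrite mulr_sumr; apply: ler_sum => P vP.
  rewrite -mulr_sumr (exprMn _ (x ^+ 3)) -!exprM -card_shadow_packing //.
  have -> : #|{: edge n}| = (#|shadow P| + #|(~: shadow P)%SET|)%N.
    by rewrite cardsC.
  rewrite exprD.
  have algL (a b e f g : R) : a * b * e * (f * g) = f * (a * (g * b * e)).
    by ring.
  have algR (a b e f : R) : a * b * (e * f) = e * (b * (a * f)) by ring.
  rewrite algL algR; apply: ler_wpM2l; first exact: exprn_ge0.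
  apply: ler_pM (one_packing P vP); rewrite ?exprn_ge0 //.
    by rewrite !mulr_ge0 ?exprn_ge0 // ltW.
  by rewrite ler_weXn2l ?lerDl // card_shadow_packing // card_packing_le.
have alg (a b e f : R) : a * b * e * f = a * e * (b * f) by ring.
rewrite [leRHS]alg.
apply: ler_wpM2l; first by rewrite mulr_ge0 ?exprn_ge0.
rewrite (exchange_big_dep xpredT) //= /graph_sum mulr_sumr.
by apply: ler_sum => G _; apply: weight.
Qed.

(** * The numbers of packings *)

Definition packing_number (n m : nat) : nat :=
  #|[set P : {set {set 'I_n}} | vertex_packing P && (#|P| == m)]%SET|.

Lemma packing_sumE (R : realType) (n : nat) (z : R) :
  packing_sum n z = \sum_(m < n.+1) (packing_number n m)%:R * z ^+ m.
Proof.
rewrite /packing_sum.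
rewrite (partition_big (fun P : {set {set 'I_n}} => inord #|P| : 'I_n.+1) predT) //=.
apply: eq_bigr => m _; rewrite /packing_number -sum1_card natr_sum mulr_suml.
apply: eq_big => [P|P /andP[vP /eqP <-]].
  rewrite inE; case: (boolP (vertex_packing P)) => //= vP.
  rewrite -val_eqE /= inordK // ltnS.
  by apply: leq_trans (card_packing_le vP); rewrite leq_pmull.
rewrite mul1r inordK // ltnS.
by apply: leq_trans (card_packing_le vP); rewrite leq_pmull.
Qed.

Lemma vertex_packingU1 (n : nat) (T : {set 'I_n}) (P : {set {set 'I_n}}) :
  T \in triples n -> T \notin P ->
  vertex_packing (T |: P)%SET = vertex_packing P && [disjoint T & finset.cover P].
Proof.
move=> Tt TP; rewrite /vertex_packing finset.subUset finset.sub1set Tt /= -andbA.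
congr (_ && _); apply/packingP/andP => [pU|[/packingP pP dT]].
  split; first by apply/packingP => i j iP jP; apply: pU; rewrite !inE ?iP ?jP orbT.
  apply/bigcup_disjoint => S SP.
  apply: (pU T S); rewrite ?inE ?eqxx ?SP ?orbT //.
  by apply: contraNneq TP => ->.
move=> i j; rewrite !inE.
move=> /ssrbool.orP[/eqP->|iP] /ssrbool.orP[/eqP->|jP] ij.
- by rewrite eqxx in ij.
- exact: (bigcup_disjointP dT).
- by rewrite disjoint_sym; apply: (bigcup_disjointP dT).
- exact: pP.
Qed.

(** Both sides count the packings of [m + 1] triples with one marked triple:
    removing the mark leaves a packing of [m] triples and a triple among the
    [n - 3 m] uncovered vertices. *)
Lemma packing_number_rec (n m : nat) :
  (m.+1 * packing_number n m.+1 = 'C(n - 3 * m, 3) * packing_number n m)%N.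
Proof.
pose pk k (P : {set {set 'I_n}}) := vertex_packing P && (#|P| == k).
transitivity (\sum_(T in triples n) \sum_(P | pk m.+1 P && (T \in P)) 1)%N.
  rewrite (exchange_big_dep (pk m.+1)) /=; last by move=> T P _ /andP[].
  rewrite mulnC /packing_number -sum_nat_const [LHS](eq_bigl (pk m.+1)); last first.
    by move=> P; rewrite inE.
  apply: eq_bigr => P /andP[vP /eqP Pm]; rewrite sum1dep_card -Pm.
  congr #|pred_of_set _|; apply/setP => T; rewrite !finset.inE /pk vP Pm eqxx /=.
  case: (boolP (T \in P)) => TP; rewrite ?andbF //= andbT.
  by case/andP: vP => /fintype.subsetP Pt _; move: (Pt T TP); rewrite inE => ->.
transitivity (\sum_(T in triples n)
    \sum_(P | pk m P && [disjoint T & finset.cover P]) 1)%N.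
  apply: eq_bigr => T Tt.
  rewrite (reindex_onto (fun P => T |: P)%SET (fun P => P :\ T)%SET) /=; last first.
    by move=> P /andP[_ TP]; rewrite finset.setD1K.
  apply: eq_bigl => P; rewrite finset.setU11 andbT.
  case: (boolP (T \in P)) => TP.
    have -> : [disjoint T & finset.cover P] = false.
      apply/negbTE; have : (0 < #|T|)%N by move: Tt; rewrite inE => /eqP ->.
      move=> /card_gt0P[v vT]; apply/negP => /disjointFr/(_ vT).
      by move/negP; apply; apply/bigcupP; exists T.
    rewrite andbF; apply/negbTE; rewrite negb_and; apply/ssrbool.orP; right.
    apply/eqP => E; move: TP; rewrite -E.
    by rewrite !finset.inE eqxx.
  rewrite finset.setU1K // eqxx andbT /pk vertex_packingU1 // cardsU1 TP add1n.
  by rewrite eqSS andbAC.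
rewrite (exchange_big_dep (pk m)) /=; last by move=> T P _ /andP[].
rewrite mulnC /packing_number -sum_nat_const [RHS](eq_bigl (pk m)); last first.
  by move=> P; rewrite inE.
apply: eq_bigr => P pkP; case/andP: (pkP) => vP /eqP Pm.
have -> : (n - 3 * m)%N = #|(~: finset.cover P)%SET|.
  by rewrite cardsCs finset.setCK card_ord card_cover_packing ?Pm.
rewrite -cards_draws sum1dep_card; congr #|pred_of_set _|.
apply/setP => T; rewrite !finset.inE pkP /= andbC; congr (_ && _).
by rewrite finset.disjoints_subset.
Qed.

Lemma packing_term_le (R : realType) (n m : nat) (z : R) :
  0 <= z -> (packing_number n m)%:R * z ^+ m <= packing_sum n z.
Proof.
move=> z0; rewrite /packing_sum (bigID (fun P : {set {set 'I_n}} => #|P| == m)) /=.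
rewrite -[leLHS]addr0; apply: lerD; last by apply: sumr_ge0 => P _; rewrite exprn_ge0.
rewrite /packing_number -sum1_card natr_sum mulr_suml le_eqVlt.
apply/ssrbool.orP; left; apply/eqP; apply: eq_big => [P|P].
  by rewrite inE.
by rewrite inE => /andP[_ /eqP ->]; rewrite mul1r.
Qed.

Lemma packing_term_rec (R : realType) (n m : nat) (z : R) :
  m.+1%:R * ((packing_number n m.+1)%:R * z ^+ m.+1)
  = ('C(n - 3 * m, 3)%:R * z) * ((packing_number n m)%:R * z ^+ m) :> R.
Proof.
rewrite mulrA -natrM packing_number_rec natrM exprS.
have -> (a b c d : R) : a * b * (c * d) = a * c * (b * d) by ring.
by [].
Qed.

(** From index [m0] on the tilted terms decrease, so each of them is at most the
    tilted term of index [m0]. *)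
Lemma packing_sum_tilt_up (R : realType) (n m0 : nat) (z q : R) :
  0 <= z -> 1 <= q ->
  (forall m, (m0 <= m)%N -> 'C(n - 3 * m, 3)%:R * z * q <= m.+1%:R) ->
  packing_sum n (z * q) <= n.+1%:R * q ^+ m0 * packing_sum n z.
Proof.
move=> z0 q1 hq; have q0 : 0 <= q by apply: le_trans q1.
pose d m : R := (packing_number n m)%:R * z ^+ m.
have d0 m : 0 <= d m by rewrite mulr_ge0 ?exprn_ge0.
have tail m : (m0 <= m)%N -> d m * q ^+ m <= q ^+ m0 * packing_sum n z.
  elim: m => [|m IH] mm.
    by move: mm; rewrite leqn0 => /eqP ->; rewrite mulrC ler_wpM2l ?exprn_ge0 ?packing_term_le.
  move: mm; rewrite leq_eqVlt => /ssrbool.orP[/eqP->|mm].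
    by rewrite mulrC ler_wpM2l ?exprn_ge0 ?packing_term_le.
  apply: le_trans (IH mm); rewrite exprS mulrA ler_wpM2r ?exprn_ge0 //.
  rewrite -(@ler_pM2l _ m.+1%:R) ?ltr0n // mulrA packing_term_rec mulrAC.
  by rewrite ler_wpM2r ?hq //; apply: d0.
rewrite packing_sumE -mulrA mulr_natl -[X in _ *+ X]card_ord -sumr_const.
apply: ler_sum => m _; rewrite exprMn mulrA -/(d m).
have [/tail//|mm] := leqP m0 m.
rewrite mulrC; apply: ler_pM; rewrite ?exprn_ge0 //.
  by rewrite ler_weXn2l // ltnW.
exact: packing_term_le.
Qed.

(** The mirror image of [packing_sum_tilt_up]: up to index [m0] the tilted terms
    increase. *)
Lemma packing_sum_tilt_down (R : realType) (n m0 : nat) (z q : R) :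
  0 <= z -> 1 <= q ->
  (forall m, (m < m0)%N -> m.+1%:R * q <= 'C(n - 3 * m, 3)%:R * z) ->
  packing_sum n (z / q) <= n.+1%:R * q^-1 ^+ m0 * packing_sum n z.
Proof.
move=> z0 q1 hq; have q0 : 0 < q by apply: lt_le_trans q1.
have qi0 : 0 <= q^-1 by rewrite invr_ge0 ltW.
pose d m : R := (packing_number n m)%:R * z ^+ m.
have d0 m : 0 <= d m by rewrite mulr_ge0 ?exprn_ge0.
have init k m : (m + k = m0)%N -> d m * q^-1 ^+ m <= q^-1 ^+ m0 * packing_sum n z.
  elim: k m => [|k IH] m mk.
    by move: mk; rewrite addn0 => ->; rewrite mulrC ler_wpM2l ?exprn_ge0 ?packing_term_le.
  have mm : (m < m0)%N by rewrite -mk addnS ltnS leq_addr.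
  apply: le_trans (IH m.+1 _); last by rewrite addSn -addnS.
  rewrite exprS mulrA ler_wpM2r ?exprn_ge0 // ler_pdivlMr //.
  rewrite -(@ler_pM2l _ m.+1%:R) ?ltr0n // packing_term_rec mulrCA mulrC.
  by rewrite ler_wpM2r ?hq //; apply: d0.
rewrite packing_sumE -mulrA mulr_natl -[X in _ *+ X]card_ord -sumr_const.
apply: ler_sum => m _; rewrite exprMn mulrA -/(d m).
have [mm|mm] := leqP m m0; first by apply: (init (m0 - m)%N); rewrite subnKC.
rewrite mulrC; apply: ler_pM; rewrite ?exprn_ge0 //.
  by rewrite ler_wiXn2l ?invf_le1 // ltnW.
exact: packing_term_le.
Qed.

Lemma packing_sum_gt0 (R : realType) (n : nat) (z : R) :
  0 <= z -> 0 < packing_sum n z.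
Proof.
move=> z0; have v0 : @vertex_packing n finset.set0.
  by rewrite /vertex_packing finset.sub0set; apply/packingP => i j; rewrite inE.
rewrite /packing_sum (bigD1 finset.set0) //= cards0 expr0 ltr_pwDl //.
by apply: sumr_ge0 => P _; rewrite exprn_ge0.
Qed.

Lemma bin3_le (R : realType) (k : nat) : 6 * 'C(k, 3)%:R <= k%:R ^+ 3 :> R.
Proof.
rewrite -natrX -natrM ler_nat mulnC -[6%N]/(3`!) bin_ffact.
rewrite !ffactnS ffactn0 muln1 !expnS expn0 muln1 !leq_mul ?leq_pred //.
exact: leq_trans (leq_pred _) (leq_pred _).
Qed.

Lemma bin3_ge (R : realType) (k : nat) :
  (2 <= k)%N -> (k%:R - 2) ^+ 3 <= 6 * 'C(k, 3)%:R :> R.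
Proof.
case: k => [//|[//|k]] _.
have -> : k.+2%:R - 2 = k%:R :> R by rewrite -addn2 natrD addrK.
rewrite -natrX -natrM ler_nat mulnC -[6%N]/(3`!) bin_ffact.
rewrite !ffactnS ffactn0 muln1 !expnS expn0 muln1 /=; nia.
Qed.

(** * The exponential random graph law *)

Lemma er_pmfE (R : realType) (n : nat) (p : R) (G : graph n) :
  p < 1 -> er_pmf p G = (1 - p) ^+ #|{: edge n}| * (p / (1 - p)) ^+ #|G|.
Proof.
move=> p1; have q0 : 1 - p != 0 by rewrite subr_eq0 gt_eqF.
rewrite /er_pmf -!prodr_const [X in _ = _ * X]big_mkcond /= -big_split /=.
apply: eq_bigr => e _; case: (e \in G); last by rewrite mulr1.
by rewrite mulrCA divff ?mulr1.
Qed.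

Lemma ergm_densityE (R : realType) (n : nat) (theta : R) (G : graph n) :
  (1 < n)%N ->
  ergm_density (1 / 3 + theta / ln n%:R) G
  = expR (ln n%:R / 3 + theta) ^+ V_T G.
Proof.
move=> n1; have ln0 : ln n%:R != 0 :> R by rewrite gt_eqF // ln_gt0 // ltr1n.
rewrite /ergm_density -expRM_natl mulrC; congr (expR (_ * _)).
by field.
Qed.

(** The common factor [(1 - p) ^+ N] of the edge probabilities cancels, and
    [n ^ beta = n^(1/3) e^theta]. *)
Lemma ergm_probE (R : realType) (n : nat) (lambda theta : R)
    (A : pred (graph n)) :
  (1 < n)%N -> lambda < n%:R ->
  let x := expR (ln n%:R / 3 + theta) in
  let w := lambda / (n%:R - lambda) in
  ergm_prob (lambda / n%:R) (1 / 3 + theta / ln n%:R) A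
  = (\sum_(G | A G) x ^+ V_T G * w ^+ #|G|) / graph_sum n x w.
Proof.
move=> n1 lambda_n x w; have n0 : 0 < n%:R :> R by rewrite ltr0n; case: (n) n1.
have p1 : lambda / n%:R < 1 by rewrite ltr_pdivrMr // mul1r.
have wE : lambda / n%:R / (1 - lambda / n%:R) = w.
  rewrite /w; field; rewrite ?gt_eqF //= subr_gt0 //.
set q := (1 - lambda / n%:R) ^+ #|{: edge n}|.
have q0 : q != 0 by rewrite expf_neq0 // gt_eqF // subr_gt0.
have term (G : graph n) :
    ergm_density (1 / 3 + theta / ln n%:R) G * er_pmf (lambda / n%:R) G
    = q * (x ^+ V_T G * w ^+ #|G|).
  by rewrite ergm_densityE // er_pmfE // wE mulrCA.
have ZE : ergm_Z n (lambda / n%:R) (1 / 3 + theta / ln n%:R)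
    = q * graph_sum n x w.
  rewrite /ergm_Z /graph_sum mulr_sumr; apply: eq_bigr => G _; exact: term.
rewrite /ergm_prob mulr_suml; apply: eq_bigr => G _.
by rewrite ZE -mulrA term invfM mulrACA mulVf // mul1r mulrC.
Qed.

(** The exponential Markov inequality; tilting by [b] and [t] only changes the two
    weights. *)
Lemma tilt_le (R : realType) (n : nat) (x w b t c : R) (A : pred (graph n)) :
  0 <= x -> 0 <= w ->
  (forall G, A G -> c <= b * (V_T G)%:R + t * #|G|%:R) ->
  \sum_(G | A G) x ^+ V_T G * w ^+ #|G|
  <= expR (- c) * graph_sum n (x * expR b) (w * expR t).
Proof.
move=> x0 w0 hA; rewrite /graph_sum mulr_sumr [leRHS](bigID A) /=.
rewrite -[leLHS]addr0; apply: lerD; last first.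
  by apply: sumr_ge0 => G _; rewrite !mulr_ge0 ?exprn_ge0 ?mulr_ge0 ?expR_ge0.
apply: ler_sum => G AG; rewrite !exprMn -!expRM_natl.
have -> (a1 a2 a3 a4 a5 : R) : a1 * (a2 * a3 * (a4 * a5)) = a2 * a4 * (a1 * a3 * a5).
  by ring.
rewrite ler_peMr ?mulr_ge0 ?exprn_ge0 // -!expRD -[leLHS]expR0 ler_expR.
have := hA G AG; lra.
Qed.

Section Asymptotics.
Local Open Scope classical_set_scope.
Local Open Scope ring_scope.

(** * Asymptotics of the normalising sum *)

(** The weight of a vertex lying in a triangle, [n^(1/3) e^theta]. *)
Definition vertex_weight (R : realType) (theta : R) (n : nat) : R :=
  expR (ln n%:R / 3 + theta).

(** The parameter [mu] is [lambda], or [lambda e^t] after a tilt of the number of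
    edges; the denominator comes from [p / (1 - p)] with [p = lambda / n] and is
    not affected by the tilt. *)
Definition edge_weight (R : realType) (lambda mu : R) (n : nat) : R :=
  mu / (n%:R - lambda).

Lemma vertex_weight_cube (R : realType) (theta : R) (n : nat) :
  (0 < n)%N -> vertex_weight theta n ^+ 3 = n%:R * expR (3 * theta).
Proof.
move=> n0; rewrite -expRM_natl mulrDr expRD mulrCA divff ?pnatr_eq0 // mulr1.
by rewrite lnK // posrE ltr0n.
Qed.

Lemma near_vertex_weight_ge (R : realType) (theta A : R) :
  \forall n \near \oo, A <= vertex_weight theta n.
Proof.
near=> n.
have n0 : (0 < n)%N by near: n; exact: nbhs_infty_gt.
have [A0|A0] := ltP A 0; first by rewrite (le_trans (ltW A0)) ?expR_ge0.
rewrite -(@ler_pXn2r _ 3) ?nnegrE ?expR_ge0 // vertex_weight_cube //.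
rewrite -ler_pdivrMr ?expR_gt0 //.
by near: n; exact: nbhs_infty_ger.
Unshelve. all: by end_near. Qed.

Lemma near_edge_weight (R : realType) (lambda mu : R) : 0 < mu ->
  \forall n \near \oo,
    0 <= edge_weight lambda mu n /\ n%:R * edge_weight lambda mu n <= 2 * mu.
Proof.
move=> mu0; near=> n.
have n1 : 1 <= n%:R :> R by near: n; exact: nbhs_infty_ger.
have n2 : 2 * lambda <= n%:R by near: n; exact: nbhs_infty_ger.
have nl : 0 < n%:R - lambda by lra.
split; first by rewrite divr_ge0 ?ltW.
by rewrite /edge_weight mulrA ler_pdivrMr //; nra.
Unshelve. all: by end_near. Qed.

(** The logarithm of the correction in [graph_sum_le] is [O(x^2)], and
    [x^2 / n = e^(3 theta) / x] tends to 0. *)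
Lemma near_graph_sum_le (R : realType) (lambda mu theta eps : R) :
  0 < mu -> 0 < eps ->
  \forall n \near \oo,
    let x := vertex_weight theta n in let w := edge_weight lambda mu n in
    graph_sum n x w <= (1 + w) ^+ #|{: edge n}| * expR (eps * n%:R) *
                       packing_sum n (x ^+ 3 * w ^+ 3).
Proof.
move=> mu0 eps0; set c := 2 * mu.
have c0 : 0 <= c by rewrite mulr_ge0 // ltW.
have c2 : 0 <= 3 * c ^+ 2 by rewrite mulr_ge0 // exprn_ge0.
pose C := 3 * c ^+ 2 + c ^+ 3 * expR (3 * c ^+ 2).
near=> n => /=.
have n0 : (0 < n)%N by near: n; exact: nbhs_infty_gt.
have n0' : 0 < n%:R :> R by rewrite ltr0n.
have x1 : 1 <= vertex_weight theta n by near: n; exact: near_vertex_weight_ge.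
have xe : expR (3 * theta) <= vertex_weight theta n.
  by near: n; exact: near_vertex_weight_ge.
have xC : eps^-1 * (C * expR (3 * theta)) <= vertex_weight theta n.
  by near: n; exact: near_vertex_weight_ge.
have [w0 nw] : 0 <= edge_weight lambda mu n /\
    n%:R * edge_weight lambda mu n <= c.
  by near: n; exact: near_edge_weight.
have x3 := vertex_weight_cube theta n0.
set x := vertex_weight theta n in x1 xe xC x3 *.
set w := edge_weight lambda mu n in w0 nw *.
have x0 : 0 < x by apply: lt_le_trans x1.
have xn : x ^+ 2 <= n%:R.
  by rewrite -(ler_pM2r x0) -exprSr x3 ler_pM2l.
set y := 3 * n%:R * x * w ^+ 2.
have nw0 : 0 <= n%:R * w by rewrite mulr_ge0 // ltW.
have ny : n%:R * y <= 3 * c ^+ 2 * x.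
  have -> : n%:R * y = 3 * (n%:R * w) ^+ 2 * x by rewrite /y; ring.
  by rewrite ler_wpM2r ?(ltW x0) // ler_wpM2l // lerXn2r.
have yle : y <= 3 * c ^+ 2.
  rewrite -(ler_pM2l n0'); apply: (le_trans ny).
  rewrite mulrC ler_wpM2r //; apply: le_trans xn.
  by rewrite expr2 ler_peMr // ltW.
apply: le_trans (@graph_sum_le _ n _ _ x1 w0 y erefl) _.
rewrite -[leLHS]mulrA -[leRHS]mulrA.
apply: ler_wpM2l; first by rewrite exprn_ge0 // addr_ge0.
rewrite ler_wpM2r ?ler_expR //.
  by apply: sumr_ge0 => P _; rewrite exprn_ge0 // mulr_ge0 ?exprn_ge0 // ltW.
apply: (@le_trans _ _ (C * x ^+ 2)).
  rewrite /C mulrDl; apply: lerD.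
    apply: (le_trans ny); rewrite ler_wpM2l //.
    by rewrite expr2 ler_peMr // ltW.
  have -> : n%:R ^+ 3 * (x ^+ 2 * w ^+ 3 * expR y)
     = (n%:R * w) ^+ 3 * expR y * x ^+ 2 by ring.
  rewrite ler_wpM2r ?exprn_ge0 ?(ltW x0) //; apply: ler_pM.
  - exact: exprn_ge0.
  - exact: expR_ge0.
  - by rewrite lerXn2r.
  - by rewrite ler_expR.
rewrite -(ler_pM2r x0) -mulrA -exprSr x3.
have -> : C * (n%:R * expR (3 * theta)) = n%:R * (C * expR (3 * theta)) by ring.
have -> : eps * n%:R * x = n%:R * (eps * x) by ring.
by rewrite ler_pM2l // -ler_pdivrMl.
Unshelve. all: by end_near. Qed.

Lemma near_poly_le_expR (R : realType) (C eps : R) (K : nat) :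
  0 < eps -> \forall n \near \oo, C * n.+1%:R ^+ K <= expR (eps * n%:R).
Proof.
move=> eps0; (* [d (n + 1) <= 1 + eps n / (K + 1)], whose power [K + 1] is below [e^(eps n)]. *)
pose d := Num.min 1 (eps / K.+1%:R).
have d0 : 0 < d by rewrite lt_min ltr01 divr_gt0 ?ltr0n.
near=> n.
have n0 : 0 < n.+1%:R :> R by rewrite ltr0n.
have h : d * n.+1%:R <= expR (eps / K.+1%:R * n%:R).
  apply: le_trans (expR_ge1Dx _).
  rewrite -[n.+1]addn1 natrD mulrDr mulr1 addrC lerD //.
    by rewrite ge_min lexx.
  by rewrite ler_wpM2r // ge_min lexx orbT.
have -> : eps * n%:R = K.+1%:R * (eps / K.+1%:R * n%:R).
  by rewrite mulrA (mulrC K.+1%:R) divfK ?pnatr_eq0.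
rewrite expRM_natl.
apply: (@le_trans _ _ ((d * n.+1%:R) ^+ K.+1)); last first.
  by rewrite lerXn2r ?nnegrE ?expR_ge0 // mulr_ge0 // ltW.
rewrite exprMn (exprS n.+1%:R) mulrA ler_wpM2r ?exprn_ge0 ?(ltW n0) //.
rewrite -ler_pdivrMl ?exprn_gt0 //.
apply: (@le_trans _ _ n%:R); last by rewrite ler_nat.
by near: n; exact: nbhs_infty_ger.
Unshelve. all: by end_near. Qed.

(** The instance [d = 1 / n] of [graph_sum_ge], where [n w] stays bounded. *)
Lemma near_graph_sum_ge (R : realType) (lambda mu theta eps : R) :
  0 < mu -> 0 < eps ->
  \forall n \near \oo,
    let x := vertex_weight theta n in let w := edge_weight lambda mu n in
    (1 + w) ^+ #|{: edge n}| * packing_sum n (x ^+ 3 * w ^+ 3)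
    <= expR (eps * n%:R) * graph_sum n x w.
Proof.
move=> mu0 eps0; set c := 2 * mu; have c0 : 0 <= c by rewrite mulr_ge0 // ltW.
pose K := (Num.trunc (2 * (c ^+ 3 + c ^+ 2))).+1.
near=> n => /=.
have n0 : (0 < n)%N by near: n; exact: nbhs_infty_gt.
have n0' : 0 < n%:R :> R by rewrite ltr0n.
have x1 : 1 <= vertex_weight theta n by near: n; exact: near_vertex_weight_ge.
have [w0 nw] : 0 <= edge_weight lambda mu n /\
    n%:R * edge_weight lambda mu n <= c.
  by near: n; exact: near_edge_weight.
set x := vertex_weight theta n in x1 *.
set w := edge_weight lambda mu n in w0 nw *.
have x0 : 0 < x by apply: lt_le_trans x1.
have nw0 : 0 <= n%:R * w by rewrite mulr_ge0 // ltW.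
have hK : 2 * (n%:R ^+ 3 * w ^+ 3 + n%:R ^+ 2 * w ^+ 2) <= K%:R.
  apply: (@le_trans _ _ (2 * (c ^+ 3 + c ^+ 2))).
    by rewrite -!exprMn ler_wpM2l // lerD // lerXn2r.
  by rewrite ltW // truncnS_gt.
have W0 : 0 <= graph_sum n x w.
  by apply: sumr_ge0 => G _; rewrite mulr_ge0 ?exprn_ge0 // ltW.
have d0 : 0 < n%:R^-1 :> R by rewrite invr_gt0.
have := graph_sum_ge x1 w0 d0 (isT : 0 < K)%N hK.
have -> : n%:R^-1 / (1 + n%:R^-1) = n.+1%:R^-1 :> R.
  by rewrite -[n.+1]addn1 natrD; field; rewrite !gt_eqF // addr_gt0.
rewrite exprVn mulrAC ler_pdivrMr ?exprn_gt0 ?ltr0n // => /le_trans; apply.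
have e1 : (1 + n%:R^-1) ^+ n <= expR 1 :> R.
  apply: (@le_trans _ _ (expR n%:R^-1 ^+ n)).
    by rewrite lerXn2r ?nnegrE ?expR_ge0 ?expR_ge1Dx // addr_ge0 // ltW.
  by rewrite -expRM_natl divff // gt_eqF.
have e2 : (1 + w) ^+ n <= expR c.
  apply: (@le_trans _ _ (expR w ^+ n)).
    by rewrite lerXn2r ?nnegrE ?expR_ge0 ?expR_ge1Dx // addr_ge0 // ltW.
  by rewrite -expRM_natl ler_expR.
rewrite mulrAC ler_wpM2r //.
apply: (@le_trans _ _ ((2 * expR 1 * expR c) * n.+1%:R ^+ K)).
  rewrite ler_wpM2r ?exprn_ge0 // -!mulrA ler_wpM2l //.
  by apply: ler_pM => //; rewrite exprn_ge0 // addr_ge0 // ltW.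
by near: n; exact: near_poly_le_expR.
Unshelve. all: by end_near. Qed.

(** * Exponential tilting *)

(** The quotient of the two sides without the exponential is the moment generating
    function [(1 + p (e^t - 1)) ^+ N] of the number of edges of [G(n, p)].  The
    summand [lambda / 2] covers the difference between [N] and [n^2 / 2] when
    [t < 0]. *)
Lemma tilted_normalisation_le (R : realType) (lambda t : R) (n : nat) :
  0 < lambda -> lambda < n%:R ->
  (1 + edge_weight lambda (lambda * expR t) n) ^+ #|{: edge n}|
  <= expR (lambda / 2 * (expR t - 1) * n%:R + lambda / 2)
     * (1 + edge_weight lambda lambda n) ^+ #|{: edge n}|.
Proof.
move=> l0 lam_n; have n0 : 0 < n%:R :> R by apply: lt_trans lam_n.
have nl : 0 < n%:R - lambda by rewrite subr_gt0.
have wl : 0 < edge_weight lambda lambda n by rewrite divr_gt0.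
set p := lambda / n%:R * (expR t - 1).
have -> : 1 + edge_weight lambda (lambda * expR t) n
    = (1 + p) * (1 + edge_weight lambda lambda n).
  by rewrite /p /edge_weight; field; rewrite ?gt_eqF.
rewrite exprMn ler_wpM2r ?exprn_ge0 ?addr_ge0 ?(ltW wl) //.
have p1 : 0 <= 1 + p.
  have -> : 1 + p = (n%:R - lambda) / n%:R + lambda / n%:R * expR t.
    by rewrite /p; field; rewrite gt_eqF.
  by rewrite addr_ge0 // ?mulr_ge0 ?expR_ge0 ?invr_ge0 ?ltW.
apply: (@le_trans _ _ (expR p ^+ #|{: edge n}|)).
  by rewrite lerXn2r ?nnegrE ?expR_ge0 ?expR_ge1Dx.
rewrite -expRM_natl ler_expR card_edge.
have b2 : 2 * 'C(n, 2)%:R = n%:R * (n%:R - 1) :> R.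
  rewrite -natrM mulnC -[2%N]/(2`!) bin_ffact !ffactnS ffactn0 muln1 natrM.
  by case: (n) n0 => [|m] _; rewrite ?mul0r // -[in X in _ = _ * X]natr1 addrK.
have -> : 'C(n, 2)%:R * p = lambda / 2 * (expR t - 1) * (n%:R - 1).
  have -> : 'C(n, 2)%:R = n%:R * (n%:R - 1) / 2 :> R.
    by rewrite -b2 mulrC mulKf.
  by rewrite /p; field; rewrite gt_eqF.
have := expR_ge0 t; nra.
Qed.

(** The weights enter [packing_sum] only through the cube of their product, which
    the tilt multiplies by [e^(3 (b + t))]. *)
Lemma near_tilted_graph_sum_le (R : realType) (lambda theta b t eps : R) :
  0 < lambda -> 0 < eps ->
  \forall n \near \oo,
    let x := vertex_weight theta n in
    let w := edge_weight lambda lambda n in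
    graph_sum n (x * expR b) (w * expR t)
      * packing_sum n (x ^+ 3 * w ^+ 3)
    <= expR ((lambda / 2 * (expR t - 1) + eps) * n%:R)
       * packing_sum n (x ^+ 3 * w ^+ 3 * expR (3 * (b + t)))
       * graph_sum n x w.
Proof.
move=> l0 e0; near=> n => /=.
have lam_n : lambda < n%:R by near: n; exact: nbhs_infty_gtr.
have le : 3 / eps * (lambda / 2) <= n%:R by near: n; exact: nbhs_infty_ger.
have up : graph_sum n (vertex_weight (theta + b) n)
    (edge_weight lambda (lambda * expR t) n)
  <= (1 + edge_weight lambda (lambda * expR t) n) ^+ #|{: edge n}| *
     expR (eps / 3 * n%:R) *
     packing_sum n (vertex_weight (theta + b) n ^+ 3 *
                    edge_weight lambda (lambda * expR t) n ^+ 3).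
  near: n; apply: near_graph_sum_le; last by rewrite divr_gt0.
  by rewrite mulr_gt0 ?expR_gt0.
have low : (1 + edge_weight lambda lambda n) ^+ #|{: edge n}|
    * packing_sum n (vertex_weight theta n ^+ 3 * edge_weight lambda lambda n ^+ 3)
  <= expR (eps / 3 * n%:R)
     * graph_sum n (vertex_weight theta n) (edge_weight lambda lambda n).
  by near: n; apply: near_graph_sum_ge => //; rewrite divr_gt0.
have tl := tilted_normalisation_le t l0 lam_n.
have xE : vertex_weight theta n * expR b = vertex_weight (theta + b) n.
  by rewrite /vertex_weight -expRD addrA.
have wE : edge_weight lambda lambda n * expR t
    = edge_weight lambda (lambda * expR t) n.
  by rewrite /edge_weight mulrAC.
have zE : vertex_weight theta n ^+ 3 * edge_weight lambda lambda n ^+ 3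
    * expR (3 * (b + t))
  = vertex_weight (theta + b) n ^+ 3 * edge_weight lambda (lambda * expR t) n ^+ 3.
  rewrite -xE -wE mulrDr expRD !expRM_natl !exprMn.
  have -> (p q r s : R) : p * q * (r * s) = p * r * (q * s) by ring.
  by [].
have x0 : 0 <= vertex_weight theta n by rewrite expR_ge0.
have w0 : 0 <= edge_weight lambda lambda n.
  by rewrite divr_ge0 ?ltW // subr_gt0.
rewrite xE wE zE; apply: le_trans (ler_wpM2r _ up) _.
  by rewrite ltW // packing_sum_gt0 // mulr_ge0 ?exprn_ge0.
set P' := packing_sum n (_ (theta + b) n ^+ 3 * _) in up *.
set P := packing_sum n _ in low *.
set N' := _ ^+ #|_| in tl up *; set N := _ ^+ #|_| in tl low.
set W := graph_sum n _ _ in low *.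
have P'0 : 0 <= P'.
  rewrite ltW // packing_sum_gt0 // mulr_ge0 ?exprn_ge0 // ?expR_ge0 //.
  by rewrite -wE mulr_ge0 ?expR_ge0.
have P0 : 0 <= P by rewrite ltW // packing_sum_gt0 // mulr_ge0 ?exprn_ge0.
set E := expR (eps / 3 * n%:R) in low *.
set F := expR (_ + lambda / 2) in tl.
have E0 : 0 <= E by rewrite expR_ge0.
have F0 : 0 <= F by rewrite expR_ge0.
apply: (@le_trans _ _ (F * E * P' * (N * P))).
  have -> (p q r s u : R) : p * q * r * (s * u) = p * s * (q * r * u) by ring.
  have -> (p q r s : R) : p * q * r * s = p * (q * r * s) by ring.
  by apply: ler_wpM2r => //; rewrite !mulr_ge0.
apply: (@le_trans _ _ (F * E * P' * (E * W))).
  by apply: ler_wpM2l => //; rewrite !mulr_ge0.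
have W0 : 0 <= W.
  by apply: sumr_ge0 => G _; rewrite mulr_ge0 ?exprn_ge0.
have -> (p q r s : R) : p * q * r * (q * s) = p * q * q * r * s by ring.
apply: ler_wpM2r => //; apply: ler_wpM2r => //.
rewrite -!expRD ler_expR.
have : lambda / 2 <= eps / 3 * n%:R.
  by rewrite -ler_pdivrMl ?divr_gt0 // invf_div.
lra.
Unshelve. all: by end_near. Qed.

Definition ergm_law (R : realType) (lambda theta : R) (n : nat)
    (A : pred (graph n)) : R :=
  ergm_prob (lambda / n%:R) (1 / 3 + theta / ln n%:R) A.

(** Only upper bounds are propagated; nonnegativity of the probabilities enters
    once, when this is turned into convergence to 0. *)
Definition vanishing (R : realType) (u : nat -> R) : Prop :=
  forall e : R, 0 < e -> \forall n \near \oo, u n <= e.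

Lemma vanishing_expR (R : realType) (u : nat -> R) (C r : R) :
  0 < r -> (\forall n \near \oo, u n <= expR (C - r * n%:R)) -> vanishing u.
Proof.
move=> r0 ur e e0; near=> n.
apply: (@le_trans _ _ (expR (C - r * n%:R))); first by near: n.
rewrite -[leRHS](@lnK _ e) ?posrE // ler_expR lerBlDr -lerBlDl.
by rewrite -ler_pdivrMl //; near: n; exact: nbhs_infty_ger.
Unshelve. all: by end_near. Qed.

Lemma ergm_law_ge0 (R : realType) (lambda theta : R) (n : nat)
    (A : pred (graph n)) :
  0 < lambda -> (1 < n)%N -> lambda < n%:R -> 0 <= ergm_law lambda theta A.
Proof.
move=> l0 n1 lam_n; rewrite /ergm_law ergm_probE //.
have w0 : 0 <= lambda / (n%:R - lambda) by rewrite divr_ge0 ?ltW // subr_gt0.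
by rewrite divr_ge0 //; apply: sumr_ge0 => G _;
   rewrite mulr_ge0 ?exprn_ge0 ?expR_ge0.
Qed.

Lemma vanishing_cover (R : realType) (lambda theta : R)
    (A B C : forall n, pred (graph n)) : 0 < lambda ->
  (\forall n \near \oo, forall G : graph n, A n G -> B n G || C n G) ->
  vanishing (fun n => ergm_law lambda theta (B n)) ->
  vanishing (fun n => ergm_law lambda theta (C n)) ->
  vanishing (fun n => ergm_law lambda theta (A n)).
Proof.
move=> l0 ABC vB vC e e0; have e2 : 0 < e / 2 by rewrite divr_gt0.
near=> n.
have n1 : (1 < n)%N by near: n; exact: nbhs_infty_gt.
have lam_n : lambda < n%:R by near: n; exact: nbhs_infty_gtr.
have hB : ergm_law lambda theta (B n) <= e / 2 by near: n; exact: vB.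
have hC : ergm_law lambda theta (C n) <= e / 2 by near: n; exact: vC.
have hA : forall G : graph n, A n G -> B n G || C n G by near: n.
apply: (@le_trans _ _ (ergm_law lambda theta (B n) + ergm_law lambda theta (C n))).
  rewrite /ergm_law !ergm_probE // -mulrDl.
  have w0 : 0 <= lambda / (n%:R - lambda) by rewrite divr_ge0 ?ltW // subr_gt0.
  have t0 (G : graph n) : 0 <= expR (ln n%:R / 3 + theta) ^+ V_T G
      * (lambda / (n%:R - lambda)) ^+ #|G|.
    by rewrite mulr_ge0 ?exprn_ge0 ?expR_ge0.
  rewrite ler_wpM2r ?invr_ge0 //; first by apply: sumr_ge0.
  rewrite big_mkcond [X in _ <= X + _]big_mkcond [X in _ <= _ + X]big_mkcond.
  rewrite -big_split /=; apply: ler_sum => G _.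
  have := hA G; case: (A n G) => [/(_ isT)|_].
    by case: (B n G); case: (C n G) => // _; rewrite ?addr0 ?add0r // lerDl.
  by case: (B n G); case: (C n G) => //; rewrite ?addr0 ?add0r // addr_ge0.
by have := lerD hB hC; rewrite -splitr.
Unshelve. all: by end_near. Qed.

Lemma near_tilted_markov (R : realType) (lambda theta b t eps : R) (c : nat -> R)
    (A : forall n, pred (graph n)) :
  0 < lambda -> 0 < eps ->
  (forall n (G : graph n), A n G -> c n <= b * (V_T G)%:R + t * #|G|%:R) ->
  \forall n \near \oo,
    let z := vertex_weight theta n ^+ 3 * edge_weight lambda lambda n ^+ 3 in
    ergm_law lambda theta (A n) * packing_sum n z
    <= expR ((lambda / 2 * (expR t - 1) + eps) * n%:R - c n)
       * packing_sum n (z * expR (3 * (b + t))).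
Proof.
move=> l0 e0 hA; near=> n => /=.
have n1 : (1 < n)%N by near: n; exact: nbhs_infty_gt.
have lam_n : lambda < n%:R by near: n; exact: nbhs_infty_gtr.
have tl : graph_sum n (vertex_weight theta n * expR b)
                      (edge_weight lambda lambda n * expR t)
      * packing_sum n (vertex_weight theta n ^+ 3 * edge_weight lambda lambda n ^+ 3)
    <= expR ((lambda / 2 * (expR t - 1) + eps) * n%:R)
       * packing_sum n (vertex_weight theta n ^+ 3 * edge_weight lambda lambda n ^+ 3
                        * expR (3 * (b + t)))
       * graph_sum n (vertex_weight theta n) (edge_weight lambda lambda n).
  by near: n; exact: near_tilted_graph_sum_le.
rewrite /ergm_law ergm_probE //.
rewrite -/(vertex_weight theta n) -/(edge_weight lambda lambda n).
set x := vertex_weight theta n in tl *; set w := edge_weight _ _ _ in tl *.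
have x0 : 0 < x by rewrite expR_gt0.
have w0 : 0 < w by rewrite divr_gt0 // subr_gt0.
have W0 : 0 < graph_sum n x w.
  rewrite /graph_sum (bigD1 finset.set0) //= ltr_pwDl //.
    by rewrite mulr_gt0 ?exprn_gt0.
  by apply: sumr_ge0 => G _; rewrite mulr_ge0 ?exprn_ge0 ?ltW.
rewrite mulrAC ler_pdivrMr //.
have P0 : 0 <= packing_sum n (x ^+ 3 * w ^+ 3).
  by rewrite ltW // packing_sum_gt0 // mulr_ge0 ?exprn_ge0 ?ltW.
apply: le_trans (ler_wpM2r P0 (tilt_le (ltW x0) (ltW w0) (hA n))) _.
rewrite addrC expRD -!(mulrA (expR (- c n))); apply: ler_wpM2l => //.
Unshelve. all: by end_near. Qed.

(** * Concentration of the edge excess *)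

Lemma expR_quadratic (R : realType) (t : R) :
  `|t| <= 1 / 2 -> expR t - 1 <= t + 2 * t ^+ 2.
Proof.
move=> /[!ler_norml] /andP[t1 t2].
have h := expR_ge1Dx (- t); have t1' : 0 < 1 - t by lra.
have : expR t * (1 - t) <= 1.
  by rewrite -[leRHS](expRxMexpNx_1 t) ler_wpM2l ?expR_ge0.
have : 1 <= (1 + t + 2 * t ^+ 2) * (1 - t) by nra.
move=> h1 h2; have := le_trans h2 h1; rewrite ler_pM2r //; lra.
Qed.

(** With opposite tilts of vertices and edges the packing sums cancel.  Both tails
    are covered, according to the sign of [t]. *)
Lemma edge_excess_vanishing (R : realType) (lambda theta t delta : R)
    (A : forall n, pred (graph n)) :
  0 < lambda -> 0 < delta -> t != 0 -> `|t| <= 1 / 2 -> lambda * `|t| <= delta / 2 ->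
  (forall n (G : graph n), A n G ->
     (t * (lambda / 2) + `|t| * delta) * n%:R <= t * (#|G|%:R - (V_T G)%:R)) ->
  vanishing (fun n => ergm_law lambda theta (A n)).
Proof.
move=> l0 d0 t0 t1 t2 hA; have t3 : 0 < `|t| by rewrite normr_gt0.
have r0 : 0 < `|t| * delta / 4 by rewrite !mulr_gt0.
apply: (@vanishing_expR _ _ 0 (`|t| * delta / 4)) => //; near=> n.
have n1 : (1 < n)%N by near: n; exact: nbhs_infty_gt.
have lam_n : lambda < n%:R by near: n; exact: nbhs_infty_gtr.
pose c m : R := (t * (lambda / 2) + `|t| * delta) * m%:R.
pose z := vertex_weight theta n ^+ 3 * edge_weight lambda lambda n ^+ 3.
have pl : ergm_law lambda theta (A n) * packing_sum n z
    <= expR ((lambda / 2 * (expR t - 1) + `|t| * delta / 4) * n%:R - c n)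
       * packing_sum n (z * expR (3 * (- t + t))).
  rewrite /z /c; near: n; apply: near_tilted_markov => // n G AG.
  by apply: le_trans (hA n G AG) _; rewrite mulrBr addrC mulNr.
have P0 : 0 < packing_sum n z.
  by rewrite packing_sum_gt0 // mulr_ge0 ?exprn_ge0 ?expR_ge0 // divr_ge0 ?ltW // subr_gt0.
move: pl; rewrite addNr mulr0 expR0 mulr1 ler_pM2r // => /le_trans; apply.
rewrite ler_expR /c -mulrBl add0r -mulNr ler_wpM2r //.
have q := expR_quadratic t1.
have : lambda / 2 * (expR t - 1) <= lambda / 2 * (t + 2 * t ^+ 2).
  by rewrite ler_wpM2l // divr_ge0 // ltW.
have : lambda * t ^+ 2 <= `|t| * delta / 2.
  rewrite -[t ^+ 2]real_normK ?num_real // expr2 mulrA mulrC -mulrA.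
  by rewrite ler_wpM2l // ltW.
lra.
Unshelve. all: by end_near. Qed.

Lemma lambda_hat_vanishing (R : realType) (lambda theta eps : R) :
  0 < lambda -> 0 < eps ->
  vanishing (fun n =>
    ergm_law lambda theta (fun G : graph n => eps < `|lambda_hat R G - lambda|)).
Proof.
move=> l0 e0; (* Small enough for the quadratic term of [e^t] to use only half of the gain. *)
pose t := Num.min (1 / 2) (eps / (4 * lambda)).
have t0 : 0 < t by rewrite lt_min !divr_gt0 // mulr_gt0.
have tn : `|t| = t by rewrite gtr0_norm.
have t1 : t <= 1 / 2 by rewrite ge_min lexx.
have t2 : lambda * t <= (eps / 2) / 2.
  apply: (@le_trans _ _ (lambda * (eps / (4 * lambda)))).
    by rewrite ler_wpM2l ?(ltW l0) // ge_min lexx orbT.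
  by rewrite le_eqVlt; apply/ssrbool.orP; left; apply/eqP; field; rewrite gt_eqF.
have e2 : 0 < eps / 2 by rewrite divr_gt0.
pose B n (G : graph n) : bool :=
  (t * (lambda / 2) + t * (eps / 2)) * n%:R <= t * (#|G|%:R - (V_T G)%:R).
pose C n (G : graph n) : bool :=
  (- t * (lambda / 2) + t * (eps / 2)) * n%:R <= - t * (#|G|%:R - (V_T G)%:R).
apply: (@vanishing_cover _ _ _ _ B C) => //.
- near=> n => G; have n0 : 0 < n%:R :> R by near: n; exact: nbhs_infty_gtr.
  rewrite /lambda_hat -mulrBl -mulrBr.
  have -> : 2 * (#|G|%:R - (V_T G)%:R) / n%:R - lambda
      = (2 * (#|G|%:R - (V_T G)%:R) - lambda * n%:R) / n%:R.
    by field; rewrite gt_eqF.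
  rewrite normrM normfV (gtr0_norm n0) ltr_pdivlMr //.
  rewrite real_lter_normr ?num_real // => /ssrbool.orP[h|h];
    apply/ssrbool.orP; [left|right]; rewrite /B /C.
    by rewrite -mulrDr -mulrA ler_pM2l //; lra.
  have -> : - t * (lambda / 2) + t * (eps / 2) = t * (eps / 2 - lambda / 2).
    by ring.
  by rewrite mulNr -mulrN -mulrA ler_pM2l //; lra.
- apply: (@edge_excess_vanishing _ _ _ t (eps / 2)); rewrite ?tn ?gt_eqF //.
- apply: (@edge_excess_vanishing _ _ _ (- t) (eps / 2));
    rewrite ?normrN ?tn ?oppr_eq0 ?gt_eqF //.
Unshelve. all: by end_near. Qed.

(** * Concentration of the vertex count *)

(** The argument of the packing sum is
    [lambda^3 e^(3 theta) / n^2] up to the factor [(n / (n - lambda))^3 >= 1]. *)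
Lemma packing_weight_ge (R : realType) (lambda theta : R) (n : nat) :
  0 < lambda -> lambda < n%:R ->
  lambda ^+ 3 * expR (3 * theta) <=
  vertex_weight theta n ^+ 3 * edge_weight lambda lambda n ^+ 3 * n%:R ^+ 2.
Proof.
move=> l0 lam_n; have n0 : 0 < n%:R :> R by apply: lt_trans lam_n.
rewrite vertex_weight_cube -?(ltr0n R) //.
have -> (a b c : R) : a * b * c * a ^+ 2 = (a ^+ 3 * c) * b by ring.
rewrite ler_wpM2r ?expR_ge0 // -exprMn lerXn2r ?nnegrE ?ltW //.
  by rewrite mulr_gt0 // divr_gt0 // subr_gt0.
rewrite mulrA ltr_pdivlMr ?subr_gt0 //; nra.
Qed.

Lemma near_packing_weight_le (R : realType) (lambda theta s : R) :
  0 < lambda -> 0 < s ->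
  \forall n \near \oo,
    vertex_weight theta n ^+ 3 * edge_weight lambda lambda n ^+ 3 * n%:R ^+ 2
    <= lambda ^+ 3 * expR (3 * theta) * expR s.
Proof.
move=> l0 s0; have E1 : 1 < expR (s / 3) by rewrite -expR0 ltr_expR divr_gt0.
near=> n.
have lam_n : lambda < n%:R by near: n; exact: nbhs_infty_gtr.
have n0 : 0 < n%:R :> R by apply: lt_trans lam_n.
have nE : lambda * expR (s / 3) / (expR (s / 3) - 1) <= n%:R.
  by near: n; exact: nbhs_infty_ger.
rewrite vertex_weight_cube -?(ltr0n R) //.
have -> (a b c : R) : a * b * c * a ^+ 2 = (a ^+ 3 * c) * b by ring.
rewrite [leRHS]mulrAC ler_wpM2r ?expR_ge0 //.
have -> : expR s = expR (s / 3) ^+ 3 by rewrite -expRM_natl mulrC divfK.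
rewrite -!exprMn lerXn2r ?nnegrE //.
- by rewrite mulr_ge0 ?divr_ge0 ?ltW // subr_gt0.
- by rewrite mulr_ge0 ?expR_ge0 ?ltW.
rewrite mulrCA ler_wpM2l ?(ltW l0) // ler_pdivrMr ?subr_gt0 //.
move: nE; rewrite ler_pdivrMr ?subr_gt0 //; lra.
Unshelve. all: by end_near. Qed.

(** For [b] beyond the balance point, the ratio of consecutive terms of the packing
    sum stays below [e^(-3 s)] for all [m >= b n / 3], for some [s > 0], so a tilt
    by [s] of the number of vertices costs no more than [e^(s b n)]. *)
Lemma vertex_count_upper (R : realType) (lambda theta b k : R) :
  0 < lambda -> 0 < b < 1 -> b < k ->
  lambda ^+ 3 * expR (3 * theta) * (1 - b) ^+ 3 < 2 * b ->
  vanishing (fun n => ergm_law lambda theta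
    (fun G : graph n => k * n%:R <= (V_T G)%:R)).
Proof.
move=> l0 /andP[b0 b1] bk hb; set zeta := lambda ^+ 3 * expR (3 * theta) in hb.
have zeta0 : 0 < zeta by rewrite mulr_gt0 ?exprn_gt0 ?expR_gt0.
have zb0 : 0 < zeta * (1 - b) ^+ 3 by rewrite mulr_gt0 ?exprn_gt0 ?subr_gt0.
(* Three quarters of the logarithmic gap are spent on the tilt, the last quarter
   on the factor [(n / (n - lambda))^3]. *)
pose s := ln (2 * b / (zeta * (1 - b) ^+ 3)) / 4.
have s0 : 0 < s by rewrite divr_gt0 // ln_gt0 // ltr_pdivlMr // mul1r.
have sE : zeta * (1 - b) ^+ 3 * expR (4 * s) = 2 * b.
  rewrite [4 * s]mulrCA divff // mulr1 lnK ?posrE ?divr_gt0 //; last exact: mulr_gt0.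
  by rewrite mulrC divfK ?gt_eqF.
pose e := s * (k - b) / 4; have e0 : 0 < e by rewrite divr_gt0 // mulr_gt0 // subr_gt0.
apply: (@vanishing_expR _ _ (3 * s) (s * (k - b) / 2)).
  by rewrite divr_gt0 // mulr_gt0 // subr_gt0.
near=> n.
have lam_n : lambda < n%:R by near: n; exact: nbhs_infty_gtr.
have n0 : 0 < n%:R :> R by apply: lt_trans lam_n.
pose z := vertex_weight theta n ^+ 3 * edge_weight lambda lambda n ^+ 3.
have zle : z * n%:R ^+ 2 <= zeta * expR s.
  by rewrite /z; near: n; exact: near_packing_weight_le.
have z0 : 0 <= z.
  by rewrite mulr_ge0 ?exprn_ge0 ?expR_ge0 // divr_ge0 ?ltW // subr_gt0.
have P0 := packing_sum_gt0 n z0.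
have poly : 1 * n.+1%:R ^+ 1 <= expR (e * n%:R).
  by near: n; exact: near_poly_le_expR.
rewrite mul1r expr1 in poly.
have : ergm_law lambda theta (fun G : graph n => k * n%:R <= (V_T G)%:R)
       * packing_sum n z
    <= expR ((lambda / 2 * (expR 0 - 1) + e) * n%:R - s * k * n%:R)
       * packing_sum n (z * expR (3 * (s + 0))).
  rewrite /z; near: n.
  apply: (near_tilted_markov _ (c := fun n => s * k * n%:R)) => // n G h.
  by rewrite mul0r addr0 -mulrA ler_wpM2l // ltW.
rewrite expR0 subrr mulr0 add0r addr0 => pl.
pose m0 := (Num.trunc (b * n%:R / 3)).+1.
have bn0 : 0 <= b * n%:R / 3 by rewrite divr_ge0 // mulr_ge0 ?ltW.
have m0gt : b * n%:R / 3 < m0%:R by rewrite truncnS_gt.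
have m0le : m0%:R <= b * n%:R / 3 + 1.
  by rewrite /m0 -natr1 lerD2r truncn_le.
have tilt : packing_sum n (z * expR (3 * s))
    <= n.+1%:R * expR (3 * s) ^+ m0 * packing_sum n z.
  apply: packing_sum_tilt_up => //.
    by rewrite -[leLHS]expR0 ler_expR mulr_ge0 ?ltW.
  move=> m mm.
  have mR : b * n%:R / 3 <= m%:R.
    by apply: (le_trans (ltW m0gt)); rewrite ler_nat.
  (* Beyond [n / 3] triples there is no room left and the binomial vanishes. *)
  have [nm|nm] := leqP n (3 * m).
    by move: nm; rewrite -subn_eq0 => /eqP ->; rewrite bin0n !mul0r.
  have bin : 6 * 'C(n - 3 * m, 3)%:R <= ((1 - b) * n%:R) ^+ 3 :> R.
    apply: le_trans (bin3_le _ _) _; rewrite lerXn2r ?nnegrE //.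
      by rewrite mulr_ge0 // subr_ge0 ltW.
    by rewrite natrB ?(ltnW nm) // natrM; lra.
  apply: (@le_trans _ _ m%:R); last by rewrite ler_nat.
  apply: le_trans mR.
  have E3 : expR s * expR (3 * s) = expR (4 * s) by rewrite -expRD; congr expR; ring.
  have n2 : 0 < n%:R ^+ 2 :> R by rewrite exprn_gt0.
  rewrite -(ler_pM2r n2).
  have -> : 'C(n - 3 * m, 3)%:R * z * expR (3 * s) * n%:R ^+ 2
     = 'C(n - 3 * m, 3)%:R * (z * n%:R ^+ 2 * expR (3 * s)) by ring.
  apply: (@le_trans _ _ ('C(n - 3 * m, 3)%:R * (zeta * expR (4 * s)))).
    by rewrite ler_wpM2l // -E3 [leRHS]mulrA ler_wpM2r ?expR_ge0.
  rewrite -(@ler_pM2l _ 6) // [leLHS]mulrA.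
  apply: (@le_trans _ _ (((1 - b) * n%:R) ^+ 3 * (zeta * expR (4 * s)))).
    by rewrite ler_wpM2r // mulr_ge0 ?expR_ge0 // ltW.
  have -> : ((1 - b) * n%:R) ^+ 3 * (zeta * expR (4 * s))
     = zeta * (1 - b) ^+ 3 * expR (4 * s) * n%:R ^+ 3 by ring.
  rewrite sE le_eqVlt; apply/ssrbool.orP; left; apply/eqP; by field.
rewrite -(ler_pM2r P0); apply: (le_trans pl).
apply: le_trans (ler_wpM2l (expR_ge0 _) tilt) _.
rewrite mulrA ler_pM2r //.
apply: (@le_trans _ _ (expR (e * n%:R - s * k * n%:R) *
   (expR (e * n%:R) * expR (m0%:R * (3 * s))))).
  by rewrite ler_wpM2l ?expR_ge0 // (expRM_natl m0) ler_wpM2r ?exprn_ge0 ?expR_ge0.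
rewrite -!expRD ler_expR.
have : m0%:R * (3 * s) <= (b * n%:R / 3 + 1) * (3 * s).
  by rewrite ler_wpM2r // mulr_ge0 // ltW.
rewrite /e; lra.
Unshelve. all: by end_near. Qed.

(** Below the balance point the ratio of consecutive terms exceeds [e^(3 s)], and
    the tilt by [- s] costs no more than [e^(- s b n)]. *)
Lemma vertex_count_lower (R : realType) (lambda theta b k : R) :
  0 < lambda -> 0 < b < 1 -> k < b ->
  2 * b < lambda ^+ 3 * expR (3 * theta) * (1 - b) ^+ 3 ->
  vanishing (fun n => ergm_law lambda theta
    (fun G : graph n => (V_T G)%:R <= k * n%:R)).
Proof.
move=> l0 /andP[b0 b1] bk hb; set zeta := lambda ^+ 3 * expR (3 * theta) in hb.
have zeta0 : 0 < zeta by rewrite mulr_gt0 ?exprn_gt0 ?expR_gt0.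
have zb0 : 0 < zeta * (1 - b) ^+ 3 by rewrite mulr_gt0 ?exprn_gt0 ?subr_gt0.
have b20 : 0 < 2 * b by rewrite mulr_gt0.
pose s := ln (zeta * (1 - b) ^+ 3 / (2 * b)) / 3.
have s0 : 0 < s by rewrite divr_gt0 // ln_gt0 // ltr_pdivlMr // mul1r.
have sE : 2 * b * expR (3 * s) = zeta * (1 - b) ^+ 3.
  rewrite [3 * s]mulrCA divff // mulr1 lnK ?posrE ?divr_gt0 //.
  by rewrite mulrC divfK ?gt_eqF.
pose e := s * (b - k) / 4; have e0 : 0 < e by rewrite divr_gt0 // mulr_gt0 // subr_gt0.
apply: (@vanishing_expR _ _ (3 * s) (s * (b - k) / 2)).
  by rewrite divr_gt0 // mulr_gt0 // subr_gt0.
near=> n.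
have lam_n : lambda < n%:R by near: n; exact: nbhs_infty_gtr.
have n0 : 0 < n%:R :> R by apply: lt_trans lam_n.
pose z := vertex_weight theta n ^+ 3 * edge_weight lambda lambda n ^+ 3.
have zge : zeta <= z * n%:R ^+ 2 by exact: packing_weight_ge.
have z0 : 0 <= z.
  by rewrite mulr_ge0 ?exprn_ge0 ?expR_ge0 // divr_ge0 ?ltW // subr_gt0.
have P0 := packing_sum_gt0 n z0.
have poly : 1 * n.+1%:R ^+ 1 <= expR (e * n%:R).
  by near: n; exact: near_poly_le_expR.
rewrite mul1r expr1 in poly.
have : ergm_law lambda theta (fun G : graph n => (V_T G)%:R <= k * n%:R)
       * packing_sum n z
    <= expR ((lambda / 2 * (expR 0 - 1) + e) * n%:R - (- s * k * n%:R))
       * packing_sum n (z * expR (3 * (- s + 0))).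
  rewrite /z; near: n.
  apply: (near_tilted_markov _ (c := fun n => - s * k * n%:R)) => // n G h.
  by rewrite mul0r addr0 -mulrA !mulNr lerN2 ler_wpM2l // ltW.
rewrite expR0 subrr mulr0 add0r addr0 mulrN expRN => pl.
pose m0 := Num.trunc (b * n%:R / 3).
have bn0 : 0 <= b * n%:R / 3 by rewrite divr_ge0 // mulr_ge0 ?ltW.
have m0gt : b * n%:R / 3 < m0%:R + 1 by rewrite natr1 truncnS_gt.
have m0le : m0%:R <= b * n%:R / 3 by rewrite truncn_le.
have tilt : packing_sum n (z / expR (3 * s))
    <= n.+1%:R * (expR (3 * s))^-1 ^+ m0 * packing_sum n z.
  apply: packing_sum_tilt_down => //.
    by rewrite -[leLHS]expR0 ler_expR mulr_ge0 ?ltW.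
  move=> m mm.
  have mR : m%:R + 1 <= b * n%:R / 3.
    by apply: le_trans m0le; rewrite natr1 ler_nat.
  have n3m : (3 * m + 2 <= n)%N.
    by rewrite -(ler_nat R) natrD natrM; nra.
  have bin : ((1 - b) * n%:R) ^+ 3 <= 6 * 'C(n - 3 * m, 3)%:R :> R.
    have le3m : (3 * m <= n)%N by apply: leq_trans n3m; apply: leq_addr.
    apply: le_trans (bin3_ge _ _); last by rewrite leq_subRL.
    have h : (1 - b) * n%:R <= (n - 3 * m)%:R - 2.
      by rewrite natrB // natrM; lra.
    have h0 : 0 <= (1 - b) * n%:R by rewrite mulr_ge0 // subr_ge0 ltW.
    by rewrite lerXn2r ?nnegrE // (le_trans h0).
  apply: (@le_trans _ _ (b * n%:R / 3 * expR (3 * s))).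
    by rewrite ler_wpM2r ?expR_ge0 // -natr1.
  have n2 : 0 < n%:R ^+ 2 :> R by rewrite exprn_gt0.
  rewrite -(ler_pM2r n2) -mulrA.
  apply: (@le_trans _ _ ('C(n - 3 * m, 3)%:R * zeta)); last first.
    by rewrite -mulrA ler_wpM2l.
  rewrite -(@ler_pM2l _ 6) // [leRHS]mulrA.
  apply: (@le_trans _ _ (((1 - b) * n%:R) ^+ 3 * zeta)); last first.
    by rewrite ler_wpM2r // ltW.
  have -> : ((1 - b) * n%:R) ^+ 3 * zeta = zeta * (1 - b) ^+ 3 * n%:R ^+ 3 by ring.
  rewrite -sE le_eqVlt; apply/ssrbool.orP; left; apply/eqP; by field.
rewrite -(ler_pM2r P0); apply: (le_trans pl).
apply: le_trans (ler_wpM2l (expR_ge0 _) tilt) _.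
rewrite mulrA ler_pM2r //.
apply: (@le_trans _ _ (expR (e * n%:R - - s * k * n%:R) *
   (expR (e * n%:R) * expR (m0%:R * - (3 * s))))).
  by rewrite ler_wpM2l ?expR_ge0 // (expRM_natl m0) expRN ler_wpM2r ?exprn_ge0 ?invr_ge0 ?expR_ge0.
rewrite -!expRD ler_expR.
have : (b * n%:R / 3 - 1) * (3 * s) <= m0%:R * (3 * s).
  by rewrite ler_wpM2r ?lerBlDr ?(ltW m0gt) // mulr_ge0 // ltW.
rewrite /e; lra.
Unshelve. all: by end_near. Qed.

(** * Maximisation of Lambda *)

(** The concave function [- y log y] lies below its tangent at [c], strictly
    outside [c]. *)
Lemma entropy_le (R : realType) (c y : R) :
  0 < c -> 0 <= y -> - (y * ln y) <= - (y * ln c) + c - y ?= iff (y == c).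
Proof.
move=> c0; rewrite le_eqVlt => /ssrbool.orP[/eqP<-|y0].
  by split; rewrite !mul0r oppr0 add0r addr0 // ltW.
have [<-|yc] := eqVneq y c; first by split; rewrite addrK ?eqxx.
have l0 : ln c - ln y != 0.
  rewrite subr_eq0; apply: contra yc => /eqP/ln_inj.
  by rewrite !posrE => -> //.
suff h : - (y * ln y) < - (y * ln c) + c - y.
  by split; [exact: ltW | rewrite lt_eqF].
have := expR_gt1Dx l0; rewrite expRD expRN !lnK ?posrE // ltr_pdivlMr //; lra.
Qed.

(** The solution [x] of [Lambda'(v, x, l) = 0], the derivative being in [v]. *)
Definition theta_estimate (R : realType) (v l : R) : R :=
  ln (2 * v) / 3 - ln (1 - v) - ln l.

(** The tangents at [1 - v] and [v / 3] to the two entropy terms bound [Lambda] by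
    an affine function, which is constant for this value of the parameter. *)
Lemma argmax_Lambda (R : realType) (v l : R) :
  0 < v < 1 -> 0 < l ->
  argmax `[0, 1]%classic (fun a => Lambda a (theta_estimate v l) l) = [set v]%classic.
Proof.
move=> /andP[v0 v1] l0; have v10 : 0 < 1 - v by rewrite subr_gt0.
have v3 : 0 < v / 3 by rewrite divr_gt0.
have l6 : ln 6 / 3 + ln (v / 3) / 3 = ln (2 * v) / 3.
  rewrite -mulrDl -lnM ?posrE //; congr (ln _ / _); by field.
have LE b : Lambda b (theta_estimate v l) l = - ((1 - b) * ln (1 - b))
    - (b / 3 * ln (b / 3)) + (ln (v / 3) / 3 - ln (1 - v) - 2 / 3) * b.
  by rewrite /Lambda /theta_estimate -l6; ring.
have bound b : 0 <= b <= 1 ->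
    Lambda b (theta_estimate v l) l <= Lambda v (theta_estimate v l) l ?= iff (b == v).
  move=> /andP[b0 b1].
  have b1' : 0 <= 1 - b by rewrite subr_ge0.
  have b3 : 0 <= b / 3 by rewrite divr_ge0.
  have [h1 e1] := entropy_le v10 b1'; have [h2 _] := entropy_le v3 b3.
  split; first by rewrite !LE; lra.
  have [->|bv] := eqVneq b v; first exact: eqxx.
  apply/lt_eqF; rewrite !LE.
  have : - ((1 - b) * ln (1 - b)) < - ((1 - b) * ln (1 - v)) + (1 - v) - (1 - b).
    rewrite lt_neqAle h1 andbT e1; apply: contra bv => /eqP h.
    by apply/eqP; lra.
  lra.
apply/seteqP; split => b /=.
  rewrite /argmax /= in_itv /= => -[b01 /(_ v)].
  rewrite /= in_itv /= (ltW v0) (ltW v1) => /(_ isT) vb.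
  by apply/eqP; rewrite -(bound b b01) eq_le vb (bound b b01).
move=> ->; rewrite /argmax /= in_itv /= (ltW v0) (ltW v1); split=> // c.
by rewrite in_itv /= => /bound[].
Qed.

(** The difference of the two sides changes sign between [0] and [1]. *)
Lemma ex_balance (R : realType) (zeta : R) :
  0 < zeta -> exists v : R, 0 < v < 1 /\ zeta * (1 - v) ^+ 3 = 2 * v.
Proof.
move=> z0; pose p : {poly R} := (2 *: 'X - zeta *: (1 - 'X) ^+ 3)%R.
have pE v : p.[v] = 2 * v - zeta * (1 - v) ^+ 3.
  by rewrite /p !hornerE.
have [|v] := @poly_ivt R p 0 1 ler01.
  by rewrite !pE; apply/andP; split; lra.
move=> /andP[v0 v1] /rootP; rewrite pE => /eqP.
rewrite subr_eq0 => /eqP E; exists v; split; last by [].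
apply/andP; split; rewrite lt_neqAle ?v0 ?v1 andbT; apply/eqP => h.
  by move: E; rewrite -h subr0 expr1n mulr0 mulr1 => z; rewrite -z ltxx in z0.
by move: E; rewrite h subrr expr0n mulr0 mulr1 => /eqP; rewrite pnatr_eq0.
Qed.

Lemma theta_estimate_of_balance (R : realType) (v l x : R) :
  0 < v < 1 -> 0 < l -> l ^+ 3 * expR (3 * x) * (1 - v) ^+ 3 = 2 * v ->
  x = theta_estimate v l.
Proof.
move=> /andP[v0 v1] l0 E; rewrite /theta_estimate -E.
have v10 : 0 < 1 - v by rewrite subr_gt0.
have l3 : 0 < l ^+ 3 by rewrite exprn_gt0.
have v3 : 0 < (1 - v) ^+ 3 by rewrite exprn_gt0.
rewrite (lnM (x := l ^+ 3 * expR (3 * x))) ?posrE ?mulr_gt0 ?expR_gt0 //.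
rewrite (lnM (x := l ^+ 3)) ?posrE ?expR_gt0 // expRK !lnXn //.
by lra.
Qed.

(** A second solution [x] would have its own maximiser [v'], obtained from
    [ex_balance]; as the maximiser is [v] for both, [x] is the same function of
    [v].  This avoids differentiating [Lambda]. *)
Lemma theta_hat_eq_unique (R : realType) (n : nat) (G : graph n) :
  let v := (V_T G)%:R / n%:R in
  0 < v < 1 -> 0 < lambda_hat R G ->
  unique (@theta_hat_eq R n G) (theta_estimate v (lambda_hat R G)).
Proof.
move=> v v01 l0; split; first by split=> //; exact: argmax_Lambda.
move=> x [_ Ex]; have z0 : 0 < lambda_hat R G ^+ 3 * expR (3 * x).
  by rewrite mulr_gt0 ?exprn_gt0 ?expR_gt0.
have [v' [v'01 E]] := ex_balance z0.
have xE := theta_estimate_of_balance v'01 l0 E.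
suff <- : v' = v by [].
have := argmax_Lambda v'01 l0; rewrite -xE Ex => h.
by have : [set v']%classic v' by []; rewrite -h.
Qed.

(** * Convergence of the estimators *)

Lemma near_ball (R : realType) (f : R -> R) (x e : R) :
  {for x, continuous f} -> 0 < e ->
  exists2 d, 0 < d & forall y, `|y - x| < d -> `|f y - f x| < e.
Proof.
move=> fx e0; have /cvgrPdist_lt/(_ e e0) := fx.
move=> /nbhs_ballP[d d0 h]; exists d => // y yd.
by rewrite distrC; apply: h; rewrite /ball /= distrC.
Qed.

Lemma theta_estimate_continuous (R : realType) (a l e : R) :
  0 < a < 1 -> 0 < l -> 0 < e ->
  exists2 d, 0 < d & forall v k, `|v - a| < d -> `|k - l| <= d ->
    [/\ 0 < v < 1, 0 < k & `|theta_estimate v k - theta_estimate a l| < e].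
Proof.
move=> /andP[a0 a1] l0 e0; have e2 : 0 < e / 2 by rewrite divr_gt0.
pose f v : R := ln (2 * v) / 3 - ln (1 - v).
have fc : {for a, continuous f}.
  have c1 : (2 * v : R) @[v --> a] --> 2 * a.
    by apply: cvgM; [exact: cvg_cst | exact: cvg_id].
  have c2 : (1 - v : R) @[v --> a] --> 1 - a.
    by apply: cvgB; [exact: cvg_cst | exact: cvg_id].
  have a2 : 0 < 2 * a by rewrite mulr_gt0.
  have a1' : 0 < 1 - a by rewrite subr_gt0.
  apply: cvgB; last exact: cvg_comp c2 (continuous_ln a1').
  by apply: cvgM; [exact: cvg_comp c1 (continuous_ln a2) | exact: cvg_cst].
have [d1 d10 h1] := near_ball fc e2.
have [d2 d20 h2] := near_ball (continuous_ln l0) e2.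
(* The last three bounds keep [v] inside [(0, 1)] and [k] positive. *)
pose d := Num.min (Num.min d1 (d2 / 2)) (Num.min (Num.min a (1 - a)) (l / 2)).
have d0 : 0 < d by rewrite !lt_min d10 divr_gt0 // a0 subr_gt0 a1 divr_gt0.
have dd1 : d <= d1 by rewrite !ge_min lexx.
have dd2 : d <= d2 / 2 by rewrite !ge_min lexx ?orbT.
have da : d <= a by rewrite !ge_min lexx ?orbT.
have da1 : d <= 1 - a by rewrite !ge_min lexx ?orbT.
have dl : d <= l / 2 by rewrite !ge_min lexx ?orbT.
exists d => // v k va kl.
have hf := h1 v (lt_le_trans va dd1).
have hl : `|ln k - ln l| < e / 2.
  by apply: h2; apply: (le_lt_trans kl); lra.
move: va kl; rewrite ltr_norml ler_norml => /andP[va1 va2] /andP[kl1 kl2].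
split; [by apply/andP; split; lra | by lra |].
rewrite /theta_estimate -/(f v) -/(f a) (splitr e).
have -> : f v - ln k - (f a - ln l) = (f v - f a) - (ln k - ln l) by ring.
by apply: le_lt_trans (ler_normB _ _) _; apply: ltrD.
Qed.

Lemma cvg_vanishing (R : realType) (u : nat -> R) :
  (\forall n \near \oo, 0 <= u n) -> vanishing u -> u @ \oo --> (0 : R).
Proof.
move=> u0 vu; apply/cvgrPdist_le => e e0; near=> n.
rewrite sub0r normrN ger0_norm; first by near: n; exact: vu.
by near: n.
Unshelve. all: by end_near. Qed.

(** Outside the exceptional events the estimator is [theta_estimate] of
    [V_T G / n] and [lambda_hat], which are close to [a] and [lambda]. *)
Lemma theta_hat_vanishing (R : realType) (lambda theta eps : R)
    (theta_hat : forall n : nat, graph n -> R) :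
  0 < lambda -> is_theta_hat theta_hat -> 0 < eps ->
  vanishing (fun n =>
    ergm_law lambda theta (fun G : graph n => eps < `|theta_hat n G - theta|)).
Proof.
move=> l0 hth e0.
pose zeta : R := lambda ^+ 3 * expR (3 * theta).
have zeta0 : 0 < zeta by rewrite mulr_gt0 ?exprn_gt0 ?expR_gt0.
have [a [a01 aE]] := ex_balance zeta0.
have thetaE := theta_estimate_of_balance a01 l0 aE.
have [d d0 hd] := theta_estimate_continuous a01 l0 e0.
have /andP[a0 a1] := a01.
pose r := Num.min d (Num.min a (1 - a)).
have r0 : 0 < r by rewrite !lt_min d0 a0 subr_gt0 a1.
have rd : r <= d by rewrite ge_min lexx.
have ra : r <= a by rewrite !ge_min lexx ?orbT.
have ra1 : r <= 1 - a by rewrite !ge_min lexx ?orbT.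
pose B n (G : graph n) : bool := d < `|lambda_hat R G - lambda|.
pose U n (G : graph n) : bool := (a + r) * n%:R <= (V_T G)%:R.
pose L n (G : graph n) : bool := (V_T G)%:R <= (a - r) * n%:R.
have vB : vanishing (fun n => ergm_law lambda theta (B n)).
  exact: lambda_hat_vanishing.
have vU : vanishing (fun n => ergm_law lambda theta (U n)).
  apply: (@vertex_count_upper _ _ _ (a + r / 2)) => //; [apply/andP; split; lra | lra |].
  apply: (@lt_le_trans _ _ (2 * (a + r / 2))) => //.
  apply: (@le_lt_trans _ _ (2 * a)); last by lra.
  rewrite -aE ler_wpM2l ?(ltW zeta0) // lerXn2r ?nnegrE; lra.
have vL : vanishing (fun n => ergm_law lambda theta (L n)).
  apply: (@vertex_count_lower _ _ _ (a - r / 2)) => //; [apply/andP; split; lra | lra |].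
  apply: (@lt_le_trans _ _ (2 * a)); first by lra.
  rewrite -aE ler_wpM2l ?(ltW zeta0) // lerXn2r ?nnegrE; lra.
pose UL n (G : graph n) : bool := U n G || L n G.
have vUL : vanishing (fun n => ergm_law lambda theta (UL n)).
  by apply: (@vanishing_cover _ _ _ UL U L) => //; near=> n.
apply: (@vanishing_cover _ _ _ _ B UL) => //; near=> n => G.
have n0 : 0 < n%:R :> R by near: n; exact: nbhs_infty_gtr.
apply: contraTT; rewrite !negb_or -!ltNge -!leNgt => /andP[hB /andP[hU hL]].
set v : R := (V_T G)%:R / n%:R.
have va : `|v - a| < d.
  apply: lt_le_trans rd; rewrite ltr_norml /v ltrBrDr ltrBlDr.
  by rewrite ltr_pdivlMr // ltr_pdivrMr // addrC hL addrC hU.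
have [v01 lh0 close] := hd _ _ va hB.
rewrite (hth n G _ (theta_hat_eq_unique v01 lh0)) thetaE.
exact: ltW.
Unshelve. all: by end_near. Qed.

End Asymptotics.

Theorem theorem4p1 (R : realType) (lambda theta : R) (hlambda : 0 < lambda)
    (theta_hat : forall n : nat, graph n -> R)
    (htheta_hat : is_theta_hat theta_hat) :
  let P_beta := fun n : nat =>
    @ergm_prob R n (lambda / n%:R) (1 / 3 + theta / ln n%:R) in
  cvg_in_prob P_beta (fun n G => lambda_hat R G) lambda /\
  cvg_in_prob P_beta theta_hat theta.
Proof.
move=> P_beta.
have P0 (A : forall n, pred (graph n)) :
    (\forall n \near \oo, 0 <= P_beta n (A n))%classic.
  near=> n; apply: ergm_law_ge0 => //; near: n.
    exact: nbhs_infty_gt.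
  exact: nbhs_infty_gtr.
split=> eps eps0; apply: cvg_vanishing; try exact: P0.
  exact: lambda_hat_vanishing.
exact: theta_hat_vanishing.
Unshelve. all: by end_near. Qed.
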